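(* Let $R$ be a regular local ring of dimension $2$, let $z\in\operatorname{QF}(R)$ be nonzero, and write $z=f/g$ with $f,g\in R$ relatively prime. Then the set of dicritical divisors of $z$ in $R$ is equal to the set of Rees valuations (Rees valuation rings) of the ideal $I:=(f,g)$ of $R$.
   Context: Let $R$ be a regular local ring of dimension $2$, with maximal ideal $\mathfrak m$, residue field $K=R/\mathfrak m$ and fraction field $\operatorname{QF}(R)$. A prime divisor of $R$ is a discrete valuation ring $V$ with fraction field $\operatorname{QF}(R)$ that dominates $R$ (i.e. $R\subseteq V$ and $\mathfrak m_v\cap R=\mathfrak m$, where $\mathfrak m_v$ is the maximal ideal of $V$) and whose residue field $K_v=V/\mathfrak m_v$ is transcendental over $K$. Write $H_v:V\to K_v$ for the canonical projection; $K$ is identified with $H_v(R)\subseteq K_v$. For $z\in\operatorname{QF}(R)$, $z\neq 0$, a dicritical divisor of $z$ in $R$ is a prime divisor $V$ of $R$ such that $z\in V$ and $H_v(z)$ is transcendental over $K$. Rees valuations: for an ideal $I$ of $R$, the set of Rees valuations of $I$ is the smallest set $\{V_1,\dots,V_e\}$ of valuation rings such that: (1) each $V_i$ is Noetherian and is not a field; (2) for each $i$ there is a minimal prime ideal $\mathfrak P_i$ of $R$ with $R/\mathfrak P_i\subseteq V_i\subseteq \operatorname{QF}(R/\mathfrak P_i)$ (here $R$ is a domain, so $\mathfrak P_i=(0)$ and $R\subseteq V_i\subseteq\operatorname{QF}(R)$); (3) for every $n\in\mathbb N$, the integral closure of $I^n$ is $\overline{I^n}=\bigcap_{i=1}^e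 (I^nV_i)\cap R$ (the empty intersection being $R$). The existence and uniqueness of this finite set is a known result. *)

(* Defs.v *)
From HB Require Import structures.
From mathcomp Require Import all_boot all_order all_algebra.
From mathcomp Require Import boolp classical_sets cardinality.

Set Implicit Arguments.
Unset Strict Implicit.
Unset Printing Implicit Defensive.

Import Order.TTheory GRing.Theory Num.Theory.

Local Open Scope classical_set_scope.
Local Open Scope ring_scope.

Notation "x %:F" := (@FracField.tofrac _ x) : ring_scope.

(* Ideal theory is developed for a subring A of an ambient ring L, so that it
   applies both to a type R (with A := [set: R]) and to the valuation rings of
   the fraction field of R, which are sets. *)
Section Ideals.
Variables (L : comNzRingType) (A : set L).
Implicit Types I J P M : set L.

Definition is_ideal I :=
  [/\ I `<=` A, I 0, forall x y, I x -> I y -> I (x + y)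
    & forall a x, A a -> I x -> I (a * x)].

(* The ideal of A generated by X; only meaningful for X `<=` A, since
   otherwise no ideal of A contains X and the intersection is [set: L]. *)
Definition ideal_gen (X : set L) : set L := smallest is_ideal X.

Definition ideal_mul I J : set L :=
  ideal_gen [set x * y | x in I & y in J].

Fixpoint ideal_exp I (n : nat) : set L :=
  if n is n'.+1 then ideal_mul I (ideal_exp I n') else A.

Definition noetherian :=
  forall I, is_ideal I ->
    exists s : seq L, [set` s] `<=` I /\ I = ideal_gen [set` s].

Definition is_prime_ideal P :=
  [/\ is_ideal P, ~ P 1
    & forall x y, A x -> A y -> P (x * y) -> P x \/ P y].

Definition is_maximal_ideal M :=
  [/\ is_ideal M, ~ M 1
    & forall J, is_ideal J -> M `<=` J -> J = M \/ J = A].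

Definition is_local_ring M :=
  is_maximal_ideal M /\ forall N, is_maximal_ideal N -> N = M.

Definition prime_chain (n : nat) :=
  exists P : nat -> set L,
    (forall i, (i <= n)%N -> is_prime_ideal (P i)) /\
    (forall i, (i < n)%N -> P i `<` P i.+1).

Definition krull_dim (n : nat) := prime_chain n /\ ~ prime_chain n.+1.

End Ideals.

Definition regular_local_ring (R : comNzRingType) (m : set R) (d : nat) :=
  [/\ noetherian [set: R], is_local_ring [set: R] m, krull_dim [set: R] d
    & exists s : d.-tuple R, m = ideal_gen [set: R] [set` s]].

(* x is integral over J: x ^+ k + a_1 x ^+ (k - 1) + ... + a_k = 0 with
   k > 0 and a_j in J ^ j; here a_j = p`_(k - j) and k = (size p).-1. *)
Definition integral_closure (R : comNzRingType) (J : set R) : set R :=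
  [set x | exists p : {poly R},
     [/\ p \is monic, root p x
       & forall i, (i < (size p).-1)%N ->
           ideal_exp [set: R] J ((size p).-1 - i) p`_i]].

Definition relatively_prime (R : comUnitRingType) (f g : R) :=
  forall d, (exists a, f = d * a) -> (exists b, g = d * b) ->
    d \is a GRing.unit.

Section Valuations.
Variable L : fieldType.
Implicit Type V : set L.

Definition is_subring V := subring_closed [in V].

(* V is a valuation ring with fraction field L. *)
Definition is_valuation_ring V :=
  is_subring V /\ forall x : L, x != 0 -> V x \/ V x^-1.

(* V is the ring of a discrete valuation v : L^* ->> int (the value of v at 0,
   which should be infinite, is irrelevant); its fraction field is L. *)
Definition is_DVR V :=
  exists v : L -> int,
    [/\ {in [pred x : L | x != 0] &, {morph v : x y / x * y >-> x + y}},
        forall x y : L, x != 0 -> y != 0 -> x + y != 0 ->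
          Num.min (v x) (v y) <= v (x + y),
        forall n, exists2 x : L, x != 0 & v x = n
      & V = [set x | x = 0 \/ 0 <= v x]].

Definition is_field V := forall x : L, V x -> x != 0 -> V x^-1.

End Valuations.

Section PrimeDivisors.
Variables (R : idomainType) (m : set R).
Let QF := {fraction R}.
Implicit Types (V mv : set QF) (y z : QF).

Definition contains_base V := forall a : R, V a%:F.

(* For y in V, with mv the maximal ideal of V and mv `&` R = m: the class of y
   in V / mv is algebraic over R / m.  A nonzero polynomial over R / m is
   the class of some p in {poly R} with a coefficient outside m, and its
   value at the class of y is the class of p.[y]. *)
Definition residue_algebraic mv y :=
  exists p : {poly R},
    (exists i, ~ m p`_i) /\ mv (map_poly (@FracField.tofrac R) p).[y].

Definition residue_transcendental mv y := ~ residue_algebraic mv y.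

Definition dominates V mv :=
  contains_base V /\ forall a : R, mv a%:F <-> m a.

Definition is_prime_divisor V mv :=
  [/\ is_DVR V, is_local_ring V mv, dominates V mv
    & exists2 y, V y & residue_transcendental mv y].

Definition dicritical_divisors z : set (set QF) :=
  [set V | exists mv,
     [/\ is_prime_divisor V mv, V z & residue_transcendental mv z]].

End PrimeDivisors.

Section Rees.
Variables (R : idomainType) (I : set R).
Let QF := {fraction R}.

Definition ideal_ext (V : set QF) (J : set R) : set QF :=
  ideal_gen V [set a%:F | a in J].

(* As R is a domain, its only minimal prime ideal is 0, so the valuation rings
   lie between R and its fraction field. For S empty the intersection below
   is the whole of R. *)
Definition Rees_conditions (S : set (set QF)) :=
  [/\ finite_set S,
      forall V, S V -> [/\ is_valuation_ring V, noetherian V & ~ is_field V],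
      forall V, S V -> contains_base V
    & forall n, integral_closure (ideal_exp [set: R] I n) =
        [set x | forall V, S V ->
                   ideal_ext V (ideal_exp [set: R] I n) x%:F]].

(* S is the set of Rees valuation rings of I, i.e. the smallest set satisfying
   the conditions above. *)
Definition is_Rees_valuations (S : set (set QF)) :=
  Rees_conditions S /\ forall T, Rees_conditions T -> S `<=` T.

End Rees.

(* Main.v *)
(* Assume that f and g are nonunits.  As R is a two-dimensional regular local
   ring, f, g is a regular sequence and (f, g) contains a power of m, so m R[f/g]
   is a prime ideal; let N be the localization of R[f/g] there.  N is a
   one-dimensional noetherian local domain, and the dicritical divisors of f/g
   are the discrete valuation rings of QF(R) that dominate N.  By the length
   argument of Krull and Akizuki every valuation ring of QF(R) that contains N,
   other than QF(R), is one of them, and they are finite in number.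

   If w/g^n lies in all of them, then it is integral over N, so that
   c (w/g^n)^i is in N for a suitable power c of g and all i.  As the form ring
   of (f, g) is a polynomial ring over R/(f, g), this gives c w^i in (f, g)^(ni),
   and w is integral over (f, g)^n since the Rees algebra is noetherian.

   If a set T of valuation rings satisfies the Rees conditions but misses a
   dicritical divisor V, approximation gives an e in all members of T but not
   in V.  One can write e = w/S with S in (f, g)^n of minimal value at V; then w
   is in (f, g)^n W for all W in T, but not in (f, g)^n V. *)

Require Import Defs.
From mathcomp Require Import all_boot all_order all_algebra.
From mathcomp Require Import boolp classical_sets functions cardinality.
From mathcomp Require Import ring zify.

Set Implicit Arguments.
Unset Strict Implicit.
Unset Printing Implicit Defensive.

Import Order.TTheory GRing.Theory Num.Theory.

Local Open Scope classical_set_scope.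
Local Open Scope ring_scope.

(** * Noetherian local domains and the Krull-Akizuki bound *)

(** The integral closure of [N] is not known to be a finite [N]-module, so both the noetherian
    property of its valuation overrings and their finite number come from a bound on chains of
    [N]-submodules of the fraction field. The members of such a chain need not lie in [N]; a power
    of [g] moves finitely many of their elements into [N], and the cost of this denominator is
    absorbed by repeating the chain many times. The same notion of length, with [x] in place of [g],
    shows that no power of [y] is a multiple of [x]; the dimension enters only here, through a chain
    of three primes. Then R/xR behaves like a discrete valuation ring, and nonzero ideals in which
    [x] can be cancelled are principal; their generators play the part of greatest common divisors.
    Nothing says that the rings in [T] contain [N], which is why the elements that test minimality
    are built from forms in [f] and [g] with coefficients in R. If [f] or [g] is a unit, then I = R
    and both sets are empty. *)

Definition subring_set (S : nzRingType) (B : set S) :=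
  [/\ B 1, forall a b, B a -> B b -> B (a - b)
    & forall a b, B a -> B b -> B (a * b)].

Section SubringSet.
Variables (S : comNzRingType) (B : set S).
Hypothesis Bring : subring_set B.

Lemma subring1 : B 1. Proof. by case: Bring. Qed.
Lemma subringB a b : B a -> B b -> B (a - b). Proof. by case: Bring => _ + _; apply. Qed.
Lemma subringM a b : B a -> B b -> B (a * b). Proof. by case: Bring => _ _; apply. Qed.
Lemma subring0 : B 0.
Proof. by rewrite -(subrr 1); apply: subringB; exact: subring1. Qed.
Lemma subringN a : B a -> B (- a).
Proof. by move=> Ba; rewrite -sub0r; apply: subringB => //; exact: subring0. Qed.
Lemma subringD a b : B a -> B b -> B (a + b).
Proof. by move=> Ba Bb; rewrite -[b]opprK; apply: subringB => //; exact: subringN. Qed.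
Lemma subringX a n : B a -> B (a ^+ n).
Proof.
move=> Ba; elim: n => [|n IHn]; first by rewrite expr0; exact: subring1.
by rewrite exprS; exact: subringM.
Qed.
Lemma subring_sum I (r : seq I) (P : pred I) (F : I -> S) :
  (forall i, P i -> B (F i)) -> B (\sum_(i <- r | P i) F i).
Proof. by move=> BF; apply: (big_ind B) => //; [exact: subring0 | exact: subringD]. Qed.

End SubringSet.

Definition submodule (S : nzRingType) (B J : set S) :=
  [/\ J 0, forall a b, J a -> J b -> J (a + b)
    & forall a b, B a -> J b -> J (a * b)].

Section Submodule.
Variables (S : comNzRingType) (B J : set S).
Hypotheses (Bring : subring_set B) (Jmod : submodule B J).

Lemma submod0 : J 0. Proof. by case: Jmod. Qed.
Lemma submodD a b : J a -> J b -> J (a + b). Proof. by case: Jmod => _ + _; apply. Qed.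
Lemma submodM a b : B a -> J b -> J (a * b). Proof. by case: Jmod => _ _; apply. Qed.
Lemma submodN a : J a -> J (- a).
Proof.
move=> Ja; rewrite -mulN1r; apply: submodM => //.
by apply: (subringN Bring); exact: subring1 Bring.
Qed.
Lemma submodB a b : J a -> J b -> J (a - b).
Proof. by move=> Ja Jb; apply: submodD => //; exact: submodN. Qed.
Lemma submod_sum I (r : seq I) (P : pred I) (F : I -> S) :
  (forall i, P i -> J (F i)) -> J (\sum_(i <- r | P i) F i).
Proof. by move=> BF; apply: (big_ind J) => //; [exact: submod0 | exact: submodD]. Qed.

End Submodule.

(* With dependent choice, this is equivalent to all ideals being finitely
   generated. *)
Definition noeth_seq (S : comNzRingType) (B : set S) :=
  forall u : nat -> S, (forall i, B (u i)) ->
  exists n (a : nat -> S), (forall i, B (a i)) /\ u n = \sum_(i < n) a i * u i.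

(** [X'] is a separate family and not the shift of [X]: in [krull_akizuki] a chain is repeated with
    growing scale factors, and at the end of each round [X' t] may be larger than [X t.+1]. *)
Definition jumps (S : Type) (X X' : nat -> set S) (E : set S) : pred nat :=
  fun t => `[< exists2 e, E e & X t e /\ ~ X' t e >].

Section NoethLocal.
Variables (S : idomainType) (B : set S).
Hypotheses (Bring : subring_set B) (Bnoeth : noeth_seq B).

Lemma nakayama_seq t (P J : set S) : B t ->
  (forall c, B c -> exists2 d, B d & (1 - t * c) * d = 1) ->
  submodule B J -> P `<=` B ->
  (forall r, P r -> exists2 r', P r' & J (r - t * r')) -> P `<=` J.
Proof.
move=> Bt tunit Jmod PB step r Pr.
have /choice[f fP] : forall r, exists r', P r -> P r' /\ J (r - t * r').
  move=> s; have [Ps|nPs] := pselect (P s); last by exists 0.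
  by have [r' ? ?] := step s Ps; exists r'.
pose u n := iter n f r.
have Pu n : P (u n) by elim: n => //= n IHn; case: (fP _ IHn).
have uJ n k : J (u n - t ^+ k * u (n + k)%N).
  elim: k => [|k IHk]; first by rewrite addn0 expr0 mul1r subrr; exact: submod0 Jmod.
  have -> : u n - t ^+ k.+1 * u (n + k.+1)%N =
    (u n - t ^+ k * u (n + k)%N)
    + t ^+ k * (u (n + k)%N - t * u (n + k).+1) by rewrite addnS exprS; ring.
  apply: (submodD Jmod) => //; apply: (submodM Jmod).
    exact: subringX.
  by have [] := fP _ (Pu (n + k)%N).
have [n [a [Ba un]]] := Bnoeth (fun i => PB _ (Pu i)).
pose c := \sum_(i < n) a i * t ^+ (n - i).-1.
have Bc : B c.
  apply: (subring_sum Bring) => i _; apply: (subringM Bring) => //.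
  exact: (subringX Bring).
have [d Bd dP] := tunit c Bc.
have Jn : J (u n).
  have -> : u n = d * ((1 - t * c) * u n) by rewrite mulrA [d * _]mulrC dP mul1r.
  apply: (submodM Jmod) => //.
  rewrite mulrBl mul1r {1}un /c mulr_sumr mulr_suml -sumrB.
  apply: (submod_sum Jmod) => i _.
  have := uJ i (n - i)%N; rewrite subnKC ?(ltnW (ltn_ord i)) // => Ji.
  have -> : a i * u i - t * (a i * t ^+ (n - i).-1) * u n
    = a i * (u i - t ^+ (n - i).-1.+1 * u n) by rewrite exprS; ring.
  by rewrite prednK ?subn_gt0 //; apply: (submodM Jmod).
have := uJ 0%N n; rewrite add0n => J0.
rewrite -[r](subrK (t ^+ n * u n)); apply: (submodD Jmod) => //.
by apply: (submodM Jmod) => //; exact: subringX.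
Qed.

(* [flen g x y E n] builds [E] from [g B] by adding [n] generators, each of
   which is killed by [x] and [y] modulo the previous ones; it says that
   [E / g B] has length at most [n] when [(x, y)] is the maximal ideal. *)
Inductive flen (g x y : S) : set S -> nat -> Prop :=
| flen0 : flen g x y [set g * b | b in B] 0
| flenS E n h of flen g x y E n & B h & E (x * h) & E (y * h) :
    flen g x y [set u | exists a e, [/\ B a, E e & u = a * h + e]] n.+1.

Section FiniteLength.
Variables (g x y : S).
Hypotheses (Bg : B g) (Bx : B x) (By : B y).

Lemma flen_submodule E n : flen g x y E n -> submodule B E.
Proof.
elim=> [|{}E {}n h _ [E0 ED EM] Bh _ _]; split.
- by exists 0; [exact: subring0|rewrite mulr0].
- move=> _ _ [a Ba <-] [b Bb <-]; exists (a + b); first exact: subringD.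
  by rewrite mulrDr.
- move=> a _ Ba [b Bb <-]; exists (a * b); first exact: subringM.
  by rewrite mulrCA.
- by exists 0, 0; split=> //; [exact: subring0|rewrite mul0r addr0].
- move=> _ _ [a [e [Ba Ee ->]]] [a' [e' [Ba' Ee' ->]]].
  exists (a + a'), (e + e'); split; [exact: subringD|exact: ED|ring].
- move=> b _ Bb [a [e [Ba Ee ->]]].
  by exists (b * a), (b * e); split; [exact: subringM|exact: EM|ring].
Qed.

Lemma flen_sub E n : flen g x y E n -> E `<=` B.
Proof.
elim=> [_ [b Bb <-]|{}E {}n h _ EB Bh _ _ _ [a [e [Ba Ee ->]]]].
  exact: subringM.
by apply: subringD => //; [exact: subringM|exact: EB].
Qed.

Lemma flen_base E n b : flen g x y E n -> B b -> E (g * b).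
Proof.
elim=> [|{}E {}n h _ EB Bh _ _] Bb; first by exists b.
exists 0, (g * b); split; [exact: subring0|exact: EB|by rewrite mul0r add0r].
Qed.

(** [flenS] wants both [x * h] and [y * h] in the previous module, so the multiples of [h] by powers
    of [y] are adjoined first, from the highest power down. *)
Lemma flen_add E n h k : flen g x y E n -> B h ->
  E (x * h) -> E (y ^+ k * h) ->
  exists E' n', [/\ flen g x y E' n', E `<=` E' & E' h].
Proof.
move=> + + + Ekh; elim: k h E n Ekh => [|k IHk] h E n Ekh EP Bh Exh.
  by exists E, n; split=> //; rewrite -[h]mul1r -(expr0 y).
have Emod := flen_submodule EP.
have [||E' [n' [E'P EE' E'h]]] := IHk (y * h) E n _ EP (subringM Bring By Bh).
- by rewrite mulrA -exprSr.
- by rewrite mulrCA; apply: (submodM Emod).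
have E'x : E' (x * h) by exact: EE'.
have E''P := flenS E'P Bh E'x E'h.
exists [set u | exists a e, [/\ B a, E' e & u = a * h + e]], n'.+1; split=> //.
  move=> e Ee; exists 0, e; split; [exact: subring0|exact: EE'|].
  by rewrite mul0r add0r.
exists 1, 0; split; [exact: subring1|exact: submod0 (flen_submodule E'P)|].
by rewrite mul1r addr0.
Qed.

(** The powers of [x] are adjoined to [g B] in decreasing order down to [1]; at each stage [y ^+ k]
    kills the new element because it is a multiple of [g]. *)
Lemma flen_full k c d : B c -> B d -> x ^+ k = g * c -> y ^+ k = g * d ->
  exists n, flen g x y B n.
Proof.
move=> Bc Bd xk yk.
suff [E [n [EP E1]]] : exists E n, flen g x y E n /\ E 1.
  exists n; suff -> : B = E by [].
  apply/seteqP; split=> [b Bb|]; last exact: flen_sub EP.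
  by rewrite -[b]mulr1; apply: (submodM (flen_submodule EP)).
suff H j : (j <= k)%N -> exists E n, flen g x y E n /\ E (x ^+ (k - j)).
  have [E [n]] := H k (leqnn k); rewrite subnn expr0 => ?.
  by exists E, n.
elim: j => [_|j IHj jk].
  exists [set g * b | b in B], 0%N; split; first exact: flen0.
  by rewrite subn0 xk; exists c.
have [E [n [EP Ej]]] := IHj (ltnW jk).
have [|||E' [n' [E'P _ E'h]]] := @flen_add E n (x ^+ (k - j.+1)) k EP.
- exact: subringX.
- by rewrite -exprS -subSn // subSS.
- rewrite yk -mulrA; apply: (flen_base EP).
  by apply: subringM => //; exact: subringX.
by exists E', n'.
Qed.

Hypothesis Blocal : forall u, B u ->
  (exists2 u', B u' & u * u' = 1)
  \/ exists a b, [/\ B a, B b & u = a * x + b * y].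

Lemma flen_dicho E h u : submodule B E -> E (x * h) -> E (y * h) -> B u ->
  (exists2 u', B u' & u * u' = 1) \/ E (u * h).
Proof.
move=> Emod Exh Eyh /Blocal[|[a [b [Ba Bb ->]]]]; [by left|right].
rewrite mulrDl -!mulrA; apply: (submodD Emod); exact: (submodM Emod).
Qed.

(** The artinian property of [E / g B]: the traces of the chain [J] on it are eventually
    constant. *)
Lemma flen_artinian E n (J : nat -> set S) : flen g x y E n ->
  (forall i, submodule B (J i)) -> (forall i j, (i <= j)%N -> J j `<=` J i) ->
  exists i, forall j u, (i <= j)%N -> J i u -> E u ->
  exists2 v, J j v & exists2 b, B b & u = v + g * b.
Proof.
move=> + Jmod Jdec.
elim=> [|{}E {}n h EP [i iP] Bh Exh Eyh].
  exists 0%N => j _ _ _ [b Bb <-]; exists 0; first exact: submod0 (Jmod j).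
  by exists b => //; rewrite add0r.
have Emod := flen_submodule EP.
(* Either every [J j] contains an element with unit coefficient at [h], and subtracting a multiple
   of it moves [u] into [E], or from [i1] on all coefficients at [h] are nonunits and [J i1] meets
   the larger module inside [E]. *)
have [allbig|/existsNP[i1 i1P]] := pselect (forall j, exists a e,
   [/\ B a, E e, J j (a * h + e) & exists2 a', B a' & a * a' = 1]).
  exists i => j u ij Ju [b [e' [Bb Ee' ue]]].
  have [a [e [Ba Ee Jae [a' Ba' aa']]]] := allbig j.
  have uE : u - (b * a') * (a * h + e) = e' - b * a' * e.
    rewrite ue; transitivity (b * h * (1 - a * a') + e' - b * a' * e); first ring.
    by rewrite aa'; ring.
  have [||v Jv [b' Bb' vb]] := iP j (u - (b * a') * (a * h + e)) ij.
  - apply: (submodB Bring (Jmod i)) => //; apply: (submodM (Jmod i)).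
      exact: subringM.
    exact: Jdec ij _ _.
  - rewrite uE; apply: (submodB Bring Emod) => //; apply: (submodM Emod) => //.
    exact: subringM.
  exists (v + b * a' * (a * h + e)).
    apply: (submodD (Jmod j)) => //; apply: (submodM (Jmod j)) => //.
    exact: subringM.
  by exists b' => //; rewrite addrAC -vb subrK.
exists (maxn i i1) => j u; rewrite geq_max => /andP[ij i1j] Ju [b [e [Bb Ee ue]]].
have Ju1 : J i1 u by apply: Jdec Ju; rewrite leq_maxr.
have Eu : E u.
  have [bu|Ebh] := flen_dicho Emod Exh Eyh Bb; last first.
    by rewrite ue; apply: (submodD Emod).
  by case: i1P; exists b, e; split=> //; rewrite -ue.
by apply: iP => //; apply: Jdec Ju; rewrite leq_maxl.
Qed.

Hypothesis gunit : forall c, B c -> exists2 d, B d & (1 - g * c) * d = 1.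

(* Krull's principal ideal theorem: with [J i] the saturation of [b ^+ i B]
   with respect to [g], the artinian property and Nakayama give
   [J i = J i.+1] for some [i]. *)
Lemma principal_ideal_thm n b : flen g x y B n -> B b -> b != 0 ->
  exists k, exists2 c, B c & g ^+ k = b * c.
Proof.
move=> BP Bb b0.
pose J i := [set r | B r /\ exists k, exists2 c, B c & g ^+ k * r = b ^+ i * c].
have Jmod i : submodule B (J i).
  split=> [|r s [Br [k [c Bc rc]]] [Bs [l [d Bd sd]]]|a r Ba [Br [k [c Bc rc]]]].
  - split; first exact: subring0.
    by exists 0%N, 0; [exact: subring0|rewrite !mulr0].
  - split; first exact: subringD.
    exists (k + l)%N, (g ^+ l * c + g ^+ k * d).
      by apply: (subringD Bring); apply: (subringM Bring) => //; exact: (subringX Bring).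
    transitivity (g ^+ l * (g ^+ k * r) + g ^+ k * (g ^+ l * s)).
      by rewrite exprD; ring.
    by rewrite rc sd; ring.
  - split; first exact: subringM.
    by exists k, (a * c); [exact: subringM|rewrite mulrCA rc mulrCA].
have Jdec i j : (i <= j)%N -> J j `<=` J i.
  move=> ij r [Br [k [c Bc rc]]]; split=> //; exists k, (b ^+ (j - i) * c).
    by apply: (subringM Bring) => //; exact: (subringX Bring).
  by rewrite rc mulrA -exprD subnKC.
have [i iP] := flen_artinian BP Jmod Jdec.
have : J i `<=` J i.+1.
  apply: (nakayama_seq Bg gunit (Jmod _)) => [r []//|r Jr].
  have [v Jv [c Bc rE]] := iP i.+1 r (leqnSn i) Jr (proj1 Jr).
  exists c; last by rewrite rE addrK.
  split=> //.
  have [_ [k [d Bd gd]]] : J i (r - v).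
    by apply: (submodB Bring (Jmod i)) => //; exact: Jdec (leqnSn i) _ _.
  exists k.+1, d => //; rewrite -gd rE; rewrite exprSr; ring.
move=> /(_ (b ^+ i)) [|_ [k [c Bc kc]]].
  split; first exact: subringX.
  by exists 0%N, 1; [exact: subring1|rewrite mulrC].
exists k, c => //; apply: (mulfI (expf_neq0 i b0)).
by rewrite mulrC kc exprS; ring.
Qed.

(* The elimination step of the length count: among the indices at which the
   chain jumps on [E + B h], at most one is not a jump on [E]. *)
Lemma flen_count E n (X X' : nat -> set S) r : flen g x y E n ->
  (forall t, submodule B (X t)) -> (forall t, submodule B (X' t)) ->
  (forall t, X' t `<=` X t) ->
  (forall t t0, (t < t0 < r)%N -> X t0 `<=` X' t) ->
  (count (jumps X X' E) (iota 0 r)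
   <= count (jumps X X' [set (g * b)%R | b in B]) (iota 0 r) + n)%N.
Proof.
move=> + Xmod X'mod X'X dec.
elim=> [|{}E {}n h EP IHn Bh Exh Eyh]; first by rewrite addn0.
have Emod := flen_submodule EP.
rewrite addnS -addn1.
set F := [set u | _].
(* If the coefficient of [h] in the witness at [t0] is a nonunit, that witness lies in [E].
   Otherwise a multiple of it, which lies in [X' t] because [t < t0], removes [h] from the witness
   at [t]. *)
have step t t0 : (t < t0 < r)%N -> jumps X X' F t -> jumps X X' F t0 -> jumps X X' E t \/ jumps X X' E t0.
  move=> tt0 /asboolP[_ [a [e [Ba Ee ->]]] [Xt X't]].
  move=> /asboolP[_ [a0 [e0 [Ba0 Ee0 ->]]] [Xt0 X't0]].
  have [[a' Ba' aa']|Ea0] := flen_dicho Emod Exh Eyh Ba0; last first.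
    by right; apply/asboolP; exists (a0 * h + e0) => //; exact: (submodD Emod).
  left; apply/asboolP; have Baa' := subringM Bring Ba Ba'.
  have Xa : X' t (a * a' * (a0 * h + e0)).
    by apply: (submodM (X'mod t)) => //; exact: dec Xt0.
  exists (a * h + e - a * a' * (a0 * h + e0)).
    have -> : a * h + e - a * a' * (a0 * h + e0)
        = a * h * (1 - a0 * a') + (e - a * a' * e0) by ring.
    rewrite aa' subrr mulr0 add0r; apply: (submodB Bring Emod) => //.
    exact: (submodM Emod).
  split.
    apply: (submodB Bring (Xmod t)) => //; apply: (submodM (Xmod t)) => //.
    exact: X'X (dec _ _ tt0 _ Xt0).
  move=> Xd; apply: X't.
  by rewrite -[a * h + e](subrK (a * a' * (a0 * h + e0))); apply: (submodD (X'mod t)).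
suff le1 : (count (jumps X X' F) (iota 0 r) <= count (jumps X X' E) (iota 0 r) + 1)%N.
  by apply: leq_trans le1 _; rewrite leq_add2r.
have [[t0 [t0r Ft0 Et0]]|noF] := pselect (exists t0,
    [/\ (t0 < r)%N, jumps X X' F t0 & ~ jumps X X' E t0]); last first.
  apply: leq_trans (leq_addr _ _).
  rewrite -!size_filter; apply: uniq_leq_size; first by rewrite filter_uniq ?iota_uniq.
  move=> t; rewrite !mem_filter mem_iota add0n => /andP[Ft tr]; rewrite tr !andbT.
  by apply: contrapT => Et; apply: noF; exists t.
have <- : count_mem t0 (iota 0 r) = 1%N.
  by rewrite count_uniq_mem ?iota_uniq // mem_iota t0r.
rewrite -count_predUI; apply: leq_trans (leq_addr _ _).
rewrite -!size_filter; apply: uniq_leq_size; first by rewrite filter_uniq ?iota_uniq.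
move=> t; rewrite !mem_filter mem_iota add0n => /andP[Ft tr]; rewrite tr !andbT /=.
have [tt0|tt0|->] := ltngtP t t0; rewrite ?orbT //= ?orbF.
- by have := step t t0; rewrite tt0 t0r => /(_ isT Ft Ft0)[->|/Et0].
- by have := step t0 t; rewrite tt0 tr => /(_ isT Ft0 Ft)[/Et0|->].
Qed.

(** Each factor [g ^+ k B / g ^+ k.+1 B] is a copy of [B / g B]: pulling the chain back along
    multiplication by [g ^+ k] reduces to [flen_count]. *)
Lemma flen_count_exp n (X X' : nat -> set S) r k : flen g x y B n ->
  (forall t, submodule B (X t)) -> (forall t, submodule B (X' t)) ->
  (forall t, X' t `<=` X t) ->
  (forall t t0, (t < t0 < r)%N -> X t0 `<=` X' t) ->
  (count (jumps X X' B) (iota 0 r)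
   <= count (jumps X X' [set (g ^+ k * b)%R | b in B]) (iota 0 r) + n * k)%N.
Proof.
move=> BP Xmod X'mod X'X dec.
have jumpsE E f (Y Y' : nat -> set S) :
    jumps Y Y' [set f * b | b in E]
    = jumps (fun t => [set u | Y t (f * u)]) (fun t => [set u | Y' t (f * u)]) E.
  apply/funext => t; apply/asboolP/asboolP => [[_ [b Eb <-] ?]|[b Eb ?]].
    by exists b.
  by exists (f * b) => //; exists b.
elim: k => [|k IHk].
  rewrite muln0 addn0 jumpsE; apply: eq_leq; congr count.
  by congr jumps; apply/funext => t; apply/funext => u; rewrite expr0 /= mul1r.
apply: leq_trans IHk _; rewrite mulnS addnA leq_add2r jumpsE.
have mod_pre (Y : nat -> set S) : (forall t, submodule B (Y t)) ->
    forall t, submodule B [set u | Y t (g ^+ k * u)].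
  move=> Ymod t; split=> /= [|a b Ya Yb|a b Ba Yb].
  - by rewrite mulr0; exact: submod0 (Ymod t).
  - by rewrite mulrDr; exact: (submodD (Ymod t)).
  - by rewrite mulrCA; exact: (submodM (Ymod t)).
apply: leq_trans (@flen_count B n _ _ r BP (mod_pre _ Xmod) (mod_pre _ X'mod) _ _) _.
- by move=> t u; exact: X'X.
- by move=> t t0 tt0 u; exact: dec.
have -> : [set g ^+ k.+1 * b | b in B] = [set g ^+ k * b | b in [set g * b | b in B]].
  apply/seteqP; split=> [_ [b Bb <-]|_ [_ [b Bb <-] <-]].
    by exists (g * b); [exists b|rewrite exprSr mulrA].
  by exists b => //; rewrite exprSr mulrA.
by rewrite [in leqRHS]jumpsE.
Qed.

(* Krull-Akizuki: the length of [Y 0 / g ^+ k Y 0] is at most [k] times that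
   of [B / g B], even if [Y 0] is not contained in [B]. *)
Lemma krull_akizuki n k c r (Y : nat -> set S) (e : nat -> S) :
  g != 0 -> flen g x y B n ->
  (forall i, submodule B (Y i)) ->
  (forall i j, (i <= j)%N -> Y j `<=` Y i) ->
  (forall u, Y 0%N u -> Y r (g ^+ k * u)) ->
  (forall b, B b -> Y r (g ^+ k * b)) ->
  (forall i, (i < r)%N -> [/\ Y i (e i), ~ Y i.+1 (e i) & B (g ^+ c * e i)]) ->
  (r <= n * k)%N.
Proof.
move=> g0 BP Ymod Ydec qY0 qB eP.
have [->//|r_gt0] := posnP r.
rewrite leqNgt; apply/negP => nk_lt_r.
(* The [e i] lie in [B] only after multiplication by [g ^+ c]. The chain is therefore repeated [N]
   times, each round scaled by a further [g ^+ k]: this gives [r * N] jumps against a bound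
   [n * (c + k * N)]. If [r > n * k], then [N <= n * c], which this choice of [N] excludes. *)
pose N := (n * c).+1.
have gq (i j : nat) (u : S) : Y 0%N u -> (i < j)%N -> Y r (g ^+ (k * (j - i)) * u).
  move=> Yu ij; rewrite -[(j - i)%N]prednK ?subn_gt0 // mulnS exprD [g ^+ k * _]mulrC -mulrA.
  by apply: (submodM (Ymod r)); [exact: subringX|exact: qY0].
pose scale t := g ^+ (c + k * (t %/ r)).
have scale0 t : scale t != 0 by rewrite expf_neq0.
pose X t := [set u | exists2 v, Y (t %% r)%N v & u = scale t * v].
pose X' t := [set u | exists2 v, Y (t %% r).+1 v & u = scale t * v].
have scale_mod (Z : set S) t : submodule B Z ->
    submodule B [set u | exists2 v, Z v & u = scale t * v].
  move=> Zmod; split=> [|_ _ [a Za ->] [b Zb ->]|a _ Ba [b Zb ->]].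
  - by exists 0; rewrite ?mulr0 //; exact: submod0 Zmod.
  - by exists (a + b); rewrite ?mulrDr //; exact: (submodD Zmod).
  - by exists (a * b); rewrite 1?mulrCA //; exact: (submodM Zmod).
have ltr t : (t %% r < r)%N by rewrite ltn_mod.
have sub_r t : Y r `<=` Y (t %% r).+1 by apply: Ydec.
have dec t t0 : (t < t0 < r * N)%N -> X t0 `<=` X' t.
  move=> /andP[tt0 _] _ [v Yv ->].
  have := leq_div2r r (ltnW tt0); rewrite leq_eqVlt => /orP[/eqP dE|dlt].
    exists v; last by rewrite /scale dE.
    apply: Ydec Yv; have := tt0; rewrite {1}(divn_eq t r) {1}(divn_eq t0 r) dE.
    by rewrite ltn_add2l.
  exists (g ^+ (k * (t0 %/ r - t %/ r)) * v).
    by apply: sub_r; apply: gq => //; exact: Ydec (leq0n _) _ Yv.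
  by rewrite mulrA -exprD -addnA -mulnDr subnKC // ltnW.
have X'X t : X' t `<=` X t.
  by move=> _ [v Yv ->]; exists v => //; exact: (Ydec _ _ (leqnSn _)).
have := flen_count_exp (c + k * N) BP (fun t => scale_mod _ t (Ymod _))
  (fun t => scale_mod _ t (Ymod _)) X'X dec.
have -> : count (jumps X X' B) (iota 0 (r * N)) = (r * N)%N.
  rewrite -[RHS](size_iota 0); apply/eqP; rewrite -all_count; apply/allP => t _.
  have [Ye nYe Be] := eP _ (ltr t).
  apply/asboolP; exists (scale t * e (t %% r)%N).
    rewrite /scale addnC exprD -mulrA; apply: subringM => //; exact: subringX.
  split; first by exists (e (t %% r)%N).
  by case=> v Yv /(mulfI (scale0 t)) ev; apply: nYe; rewrite ev.
(* By [qB], all of [g ^+ (c + k * N) B] lies in every [X' t] with [t < r * N], so no jump is left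
   there. *)
rewrite (_ : count _ _ = 0%N) => [|]; last first.
  rewrite (@eq_in_count _ _ pred0) ?count_pred0 // => t.
  rewrite mem_iota add0n /= => tlt.
  apply/negbTE/negP => /asboolP[_ [b Bb <-] [_]]; apply.
  have tN : (t %/ r < N)%N by rewrite ltn_divLR // mulnC.
  exists (g ^+ (k * (N - t %/ r)) * b); last first.
    by rewrite mulrA -exprD -addnA -mulnDr subnKC // ltnW.
  apply: sub_r; rewrite -[(N - _)%N]prednK ?subn_gt0 // mulnS exprD [g ^+ k * _]mulrC -mulrA.
  by apply: (submodM (Ymod r)); [exact: subringX|exact: qB].
rewrite add0n mulnDr mulnA => le1.
have : ((n * k).+1 * N <= n * c + n * k * N)%N by apply: leq_trans le1; rewrite leq_mul2r nk_lt_r orbT.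
by rewrite mulSn leq_add2r ltnn.
Qed.

End FiniteLength.
End NoethLocal.

(** * Regular local rings of dimension two *)

(** [Zorn_bigcup] also asks for the union of the empty chain, so the empty set is added to the
    family; since [X0] is nonempty, it cannot be the maximal element. *)
Lemma Zorn_above (T : Type) (Q : set (set T)) (X0 : set T) :
  X0 !=set0 -> Q X0 ->
  (forall F : set (set T), F !=set0 -> F `<=` Q -> (forall X, F X -> X0 `<=` X) ->
     total_on F subset -> Q (\bigcup_(X in F) X)) ->
  exists A, [/\ Q A, X0 `<=` A & forall B, A `<=` B -> Q B -> B `<=` A].
Proof.
move=> [t0 X0t0] QX0 Qchain.
have [F FP Ftot|A [[A0|[QA X0A]] Amax]] :=
    @Zorn_bigcup T [set X | X = set0 \/ (Q X /\ X0 `<=` X)].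
- have [[X FX [QX X0X]]|noX] := pselect (exists2 X, F X & Q X /\ X0 `<=` X); last first.
    left; apply/seteqP; split=> // t [X FX Xt]; case: (FP X FX) => [X0'|QX].
      by rewrite X0' in Xt.
    by case: noX; exists X.
  right; pose F' := F `&` [set X | Q X /\ X0 `<=` X].
  have -> : \bigcup_(X in F) X = \bigcup_(X in F') X.
    apply/seteqP; split=> t [Y FY Yt]; last by exists Y => //; case: FY.
    by exists Y => //; split=> //; case: (FP Y FY) => // Y0; rewrite Y0 in Yt.
  split; last by move=> t Xt; exists X => //; exact: X0X.
  apply: Qchain => [|Y [_ []]//|Y [_ []]//|Y Z [FY _] [FZ _]]; last exact: Ftot.
  by exists X; split.
- have [] : False; apply: (Amax X0); last by right; split.
  by rewrite A0; split=> // /(_ _ X0t0).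
- exists A; split=> // B AB QB t Bt; apply: contrapT => nAt.
  by case: (Amax B); [split=> // /(_ _ Bt)|right; split=> //; exact: subset_trans AB].
Qed.

Section IdealGen.
Variables (S : comNzRingType) (A : set S).
Hypothesis Aring : subring_set A.

Lemma is_idealP I : is_ideal A I <-> submodule A I /\ I `<=` A.
Proof. by split=> [[]|[[]]]; do ?split. Qed.

Lemma is_ideal_self : is_ideal A A.
Proof.
split=> //; [exact: subring0|exact: subringD|exact: subringM].
Qed.

Lemma ideal_gen_is_ideal (X : set S) : X `<=` A -> is_ideal A (ideal_gen A X).
Proof.
move=> XA; split=> [u|I [[]]//|u v gu gv I II|a u Aa gu I II].
- by apply; split=> //; exact: is_ideal_self.
- by case: (II) => -[_ _ + _] _; apply; [exact: gu|exact: gv].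
- by case: (II) => -[_ _ _ +] _; apply=> //; exact: gu.
Qed.

Lemma noetherian_seq : noetherian A -> noeth_seq A.
Proof.
move=> Anoeth u Au.
pose J n := [set v | exists a : nat -> S, (forall i, A (a i)) /\ v = \sum_(i < n) a i * u i].
have JA n : J n `<=` A.
  move=> _ [a [Aa ->]]; apply: (subring_sum Aring) => i _; exact: (subringM Aring).
have Jincr n k : (n <= k)%N -> J n `<=` J k.
  move=> nk _ [a [Aa ->]]; exists (fun i => if (i < n)%N then a i else 0).
  split=> [i|]; first by case: ifP => // _; exact: (subring0 Aring).
  rewrite (big_ord_widen k (fun i => a i * u i) nk) big_mkcond.
  by apply: eq_bigr => i _; case: ifP => // _; rewrite mul0r.
have Jmod n : submodule A (J n).
  split=> [|_ _ [a [Aa ->]] [b [Ab ->]]|c _ Ac [a [Aa ->]]].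
  - exists (fun=> 0); split=> [i|]; first exact: (subring0 Aring).
    by rewrite big1 // => i _; rewrite mul0r.
  - exists (fun i => a i + b i); split=> [i|]; first exact: (subringD Aring).
    by rewrite -big_split; apply: eq_bigr => i _; rewrite mulrDl.
  - exists (fun i => c * a i); split=> [i|]; first exact: (subringM Aring).
    by rewrite mulr_sumr; apply: eq_bigr => i _; rewrite mulrA.
have Jideal : is_ideal A (\bigcup_n J n).
  split=> [v [n _ /JA//]||a b [n _ Ja] [k _ Jb]|c v Ac [n _ Jv]].
  - by exists 0%N => //; exact: (submod0 (Jmod _)).
  - exists (maxn n k) => //; apply: (submodD (Jmod _)).
      exact: (Jincr n _ (leq_maxl _ _)).
    exact: (Jincr k _ (leq_maxr _ _)).
  - by exists n => //; exact: (submodM (Jmod n)).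
have [s [sJ JE]] := Anoeth _ Jideal.
have [n sn] : exists n, [set` s] `<=` J n.
  elim: s sJ {JE} => [|v s IHs] sJ; first by exists 0%N.
  have [n sn] : exists n, [set` s] `<=` J n.
    by apply: IHs => w sw; apply: sJ; rewrite /= inE sw orbT.
  have [k _ Jv] : (\bigcup_n J n) v by apply: sJ; rewrite /= inE eqxx.
  exists (maxn n k) => w; rewrite /= inE => /orP[/eqP->|sw].
    exact: (Jincr k _ (leq_maxr _ _)).
  by apply: (Jincr n _ (leq_maxl _ _)); exact: sn.
have /(_ (u n)) : \bigcup_n J n `<=` J n.
  rewrite JE; apply: smallest_sub => //; apply/is_idealP; split=> //; exact: Jmod.
case=> [|a [Aa uE]]; last by exists n, a.
exists n.+1 => //; exists (fun i => if i == n then 1 else 0); split=> [i|].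
  by case: ifP => _; [exact: (subring1 Aring)|exact: (subring0 Aring)].
rewrite big_ord_recr /= eqxx mul1r big1 ?add0r // => i _.
by rewrite ltn_eqF ?mul0r.
Qed.

End IdealGen.

Lemma setT_subring (S : nzRingType) : subring_set [set: S].
Proof. by []. Qed.

Lemma ideal_genP (S : comNzRingType) (X : seq S) u :
  ideal_gen [set: S] [set` X] u <->
  exists a : nat -> S, u = \sum_(i < size X) a i * X`_i.
Proof.
split.
  suff : ideal_gen [set: S] [set` X] `<=`
      [set u | exists a : nat -> S, u = \sum_(i < size X) a i * X`_i] by apply.
  apply: smallest_sub.
    split=> //.
    - by exists (fun=> 0); rewrite big1 // => i _; rewrite mul0r.
    - move=> _ _ [a ->] [b ->]; exists (fun i => a i + b i).
      by rewrite -big_split; apply: eq_bigr => i _; rewrite mulrDl.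
    - move=> c _ _ [a ->]; exists (fun i => c * a i).
      by rewrite mulr_sumr; apply: eq_bigr => i _; rewrite mulrA.
  move=> v /= Xv; exists (fun i => if i == index v X then 1 else 0).
  rewrite -index_mem in Xv; rewrite (bigD1 (Ordinal Xv)) //= eqxx mul1r nth_index -?index_mem //.
  rewrite big1 ?addr0 // => i /eqP ni; rewrite ifF ?mul0r //; apply/eqP => iE.
  by apply: ni; apply/val_inj.
case=> a ->; have gen := @ideal_gen_is_ideal S setT (setT_subring S) [set` X] (fun _ _ => I).
have /is_idealP [gmod _] := gen.
apply: (submod_sum gmod) => i _; apply: (submodM gmod) => //.
by apply: sub_gen_smallest; exact: mem_nth.
Qed.

(** [is_local_ring] says only that [m] is the unique maximal ideal; Zorn's lemma provides a maximal
    ideal containing a given nonunit. *)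
Lemma local_unit (R : comUnitRingType) (m : set R) u :
  is_local_ring [set: R] m -> ~ m u -> u \is a GRing.unit.
Proof.
move=> [_ mP] nmu; apply: contrapT => nunit; apply: nmu.
pose Q := [set X : set R | is_ideal [set: R] X /\ ~ X 1].
have [||F [X0 FX0] FQ _ Ftot|A [[Aideal A1] uA Amax]] :=
    @Zorn_above _ Q [set u * r | r in [set: R]].
- by exists 0, 0; rewrite ?mulr0.
- split; first split=> //.
  + by exists 0; rewrite ?mulr0.
  + by move=> _ _ [a _ <-] [b _ <-]; exists (a + b); rewrite ?mulrDr.
  + by move=> a _ _ [b _ <-]; exists (a * b); rewrite // mulrCA.
  + by case=> r _ ur; apply: nunit; apply/unitrPr; exists r.
- split; last by case=> X FX; apply: (proj2 (FQ X FX)).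
  split=> //.
  + by exists X0 => //; case: (FQ _ FX0) => -[].
  + move=> a b [X FX Xa] [Y FY Yb].
    have [XY|YX] := Ftot X Y FX FY.
      by exists Y => //; case: (FQ _ FY) => -[_ _ + _] _; apply=> //; exact: XY.
    by exists X => //; case: (FQ _ FX) => -[_ _ + _] _; apply=> //; exact: YX.
  + by move=> a b _ [X FX Xb]; exists X => //; case: (FQ _ FX) => -[_ _ _ +] _; apply.
have -> : m = A.
  symmetry; apply: mP; split=> // J Jideal AJ.
  have [J1|nJ1] := pselect (J 1).
    right; apply/seteqP; split=> // r _.
    by rewrite -[r]mulr1; case: Jideal => _ _ _; apply.
  by left; apply/seteqP; split=> //; exact: Amax.
by apply: uA; exists 1; rewrite ?mulr1.
Qed.

Lemma relatively_primeC (R : comUnitRingType) (f g : R) :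
  relatively_prime f g -> relatively_prime g f.
Proof. by move=> cofg d df dg; exact: cofg. Qed.

Section RegularLocal.
Variables (R : idomainType) (m : set R) (x y : R).

(** What is used of the local ring apart from its dimension, in a form symmetric in [x] and [y], so
    that lemmas can be applied with the parameters exchanged. *)
Record params := Params {
  par_noeth : noeth_seq [set: R];
  par_mE : forall u, m u <-> exists a b, u = a * x + b * y;
  par_m1 : ~ m 1;
  par_unit : forall u, ~ m u -> u \is a GRing.unit }.

Lemma par_x (P : params) : m x.
Proof. by apply/(par_mE P); exists 1, 0; rewrite mul1r mul0r addr0. Qed.

Lemma par_y (P : params) : m y.
Proof. by apply/(par_mE P); exists 0, 1; rewrite mul1r mul0r add0r. Qed.

Lemma par_mod (P : params) : submodule [set: R] m.
Proof.
split=> [|_ _ /(par_mE P)[a [b ->]] /(par_mE P)[c [d ->]]|c _ _ /(par_mE P)[a [b ->]]].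
- by apply/(par_mE P); exists 0, 0; rewrite !mul0r addr0.
- by apply/(par_mE P); exists (a + c), (b + d); ring.
- by apply/(par_mE P); exists (c * a), (c * b); ring.
Qed.

Lemma par_nonunit (P : params) u : m u -> ~ u \is a GRing.unit.
Proof.
move=> mu uu; apply: (par_m1 P); rewrite -(mulVr uu).
exact: (submodM (par_mod P)).
Qed.

Lemma par_sub1 (P : params) t c : m t -> exists2 d, [set: R] d & (1 - t * c) * d = 1.
Proof.
move=> mt; have u1 : 1 - t * c \is a GRing.unit.
  apply: (par_unit P) => m1tc; apply: (par_m1 P); rewrite -[1](subrK (t * c)).
  apply: (submodD (par_mod P)) => //; rewrite mulrC; exact: (submodM (par_mod P)).
by exists (1 - t * c)^-1; rewrite ?mulrV.
Qed.

Lemma par_local (P : params) u : [set: R] u ->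
  (exists2 u', [set: R] u' & u * u' = 1)
  \/ exists a b, [/\ [set: R] a, [set: R] b & u = a * x + b * y].
Proof.
move=> _; have [/(par_mE P)[a [b ->]]|nmu] := pselect (m u).
  by right; exists a, b.
by left; exists u^-1; rewrite ?mulrV //; exact: (par_unit P).
Qed.

(** Otherwise R/xR has finite length, and by [principal_ideal_thm] with [g := x] every nonzero
    element divides a power of [x]. For an element of [C 1] outside [C 0] this puts [x], hence [y],
    in [C 1], so that [C 1] is already the maximal ideal and leaves no room for [C 2]. *)
Lemma par_not_pow (P : params) k c : prime_chain [set: R] 2 -> y ^+ k <> x * c.
Proof.
move=> [C [Cprime Cchain]] yk.
have [P1ideal nP1 P1prime] : is_prime_ideal [set: R] (C 1%N) by exact: Cprime.
have [P2ideal nP2 _] : is_prime_ideal [set: R] (C 2%N) by exact: Cprime.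
have [b P1b nP0b] : exists2 b, C 1%N b & ~ C 0%N b.
  by have [_ /existsNP[b /not_implyP[? ?]]] := Cchain 0%N isT; exists b.
have b0 : b != 0.
  apply/eqP => b0; apply: nP0b; rewrite b0.
  by have [[_ ? _ _] _ _] : is_prime_ideal [set: R] (C 0%N) by exact: Cprime.
have xx1 : x ^+ 1 = x * 1 by rewrite expr1 mulr1.
have xk : x ^+ k.+1 = x * x ^+ k by rewrite exprS.
have yk1 : y ^+ k.+1 = x * (y * c) by rewrite exprS yk mulrCA.
have [n flenn] := flen_full (setT_subring R) I I I I I xk yk1.
have [l [d _ xl]] := principal_ideal_thm (setT_subring R) (par_noeth P) I (par_local P)
  (fun c _ => par_sub1 P c (par_x P)) flenn I b0.
have P1M a u : C 1%N u -> C 1%N (a * u) by case: P1ideal => _ _ _; apply.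
have P1X a j : C 1%N (a ^+ j) -> C 1%N a.
  elim: j => [|j IHj]; first by rewrite expr0.
  by rewrite exprS => /P1prime[].
have P1x : C 1%N x by apply: (P1X _ l); rewrite xl mulrC; exact: P1M.
have P1y : C 1%N y by apply: (P1X _ k); rewrite yk mulrC; exact: P1M.
have [_ [v P2v nP1v]] : C 1%N `<=` C 2%N /\ exists2 v, C 2%N v & ~ C 1%N v.
  by have [? /existsNP[v /not_implyP[? ?]]] := Cchain 1%N isT; split=> //; exists v.
have [/(par_mE P)[a [b' vE]]|/(par_unit P) vu] := pselect (m v).
  apply: nP1v; rewrite vE; case: P1ideal => _ _ + _; apply; exact: P1M.
by apply: nP2; rewrite -(mulVr vu); case: P2ideal => _ _ _; apply.
Qed.

Hypothesis P : params.
Hypotheses (x0 : x != 0) (yNx : forall k c, y ^+ k <> x * c).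

(** Modulo [x], a nonzero element is a unit times a power of [y]. An element without such a form is
    a nonunit [a * x + b * y], where [b] again has no such form, so [nakayama_seq] applies to the
    set of these elements. *)
Lemma par_order r : ~ (exists c, r = x * c) ->
  exists u k c, u \is a GRing.unit /\ r = u * y ^+ k + x * c.
Proof.
move=> nr; apply: contrapT => nex; apply: nr.
have Jmod : submodule [set: R] [set r | exists c, r = x * c].
  split=> [|_ _ [c ->] [d ->]|a _ _ [c ->]].
  - by exists 0; rewrite mulr0.
  - by exists (c + d); ring.
  - by exists (a * c); ring.
have := @nakayama_seq R setT (setT_subring R) (par_noeth P) y
  [set r | ~ exists u k c, u \is a GRing.unit /\ r = u * y ^+ k + x * c] _ I
  (fun c _ => par_sub1 P c (par_y P)) Jmod (fun _ _ => I).
apply=> {nex} // s /= nex.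
have [/(par_mE P)[a [b sE]]|/(par_unit P) su] := pselect (m s); last first.
  by case: nex; exists s, 0%N, 0; split=> //; rewrite mulr0 addr0 mulr1.
exists b; last by exists a; rewrite sE; ring.
case=> u [k [c [uu bE]]]; apply: nex; exists u, k.+1, (a + y * c); split=> //.
by rewrite sE bE exprS; ring.
Qed.

Lemma par_prime r s c : r * s = x * c -> (exists d, r = x * d) \/ exists d, s = x * d.
Proof.
move=> rs; apply: contrapT => /not_orP[/par_order[u [k [d [uu rE]]]]].
move=> /par_order[u' [k' [d' [uu' sE]]]].
apply: (@yNx (k + k')%N (u^-1 * u'^-1 * (c - u * y ^+ k * d' - d * u' * y ^+ k' - x * d * d'))).
have : u * u' * y ^+ (k + k') = x * (c - u * y ^+ k * d' - d * u' * y ^+ k' - x * d * d').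
  rewrite !mulrBr -rs rE sE exprD; ring.
move=> /(congr1 (fun t => u^-1 * u'^-1 * t)) E.
rewrite [RHS]mulrCA -E.
by rewrite mulrA [X in X * _](_ : _ = (u^-1 * u) * (u'^-1 * u')); [rewrite !mulVr // !mul1r|ring].
Qed.

(** A generator is an element [p] of [J] whose order in [y] modulo [x] is least. Any [r] in [J] is
    [a * p + x * d], where [d] is in [J] because [x] can be cancelled, and Nakayama's lemma for [x]
    concludes. *)
Lemma par_principal (J : set R) f : submodule [set: R] J ->
  (forall r, J (x * r) -> J r) -> J f -> f != 0 ->
  exists2 p, J p & forall r, J r -> exists c, r = p * c.
Proof.
move=> Jmod Jx Jf f0.
have nak J' t : m t -> submodule [set: R] J' ->
    (forall r, J r -> exists2 r', J r' & J' (r - t * r')) -> J `<=` J'.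
  move=> mt J'mod; exact: (@nakayama_seq R setT (setT_subring R) (par_noeth P) t
    J J' I (fun c _ => par_sub1 P c mt) J'mod (fun _ _ => I)).
pose ok k := `[< exists u c, u \is a GRing.unit /\ J (u * y ^+ k + x * c) >].
have [exk|noJ] := pselect (exists k, ok k); last first.
  have /(_ f Jf) /= : J `<=` [set 0].
    apply: (nak _ _ (par_x P)) => [|r Jr].
      by split=> [//|_ _ -> ->|a _ _ ->]; rewrite ?addr0 ?mulr0.
    have [c rE] : exists c, r = x * c.
      apply: contrapT => /par_order[u [k [c [uu rE]]]]; apply: noJ; exists k.
      by apply/asboolP; exists u, c; rewrite -rE.
    by exists c; [apply: Jx; rewrite -rE|rewrite rE subrr].
  by move=> fE; rewrite fE eqxx in f0.
case: (ex_minnP exk) => k /asboolP[u [c [uu Jp]]] kmin.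
exists (u * y ^+ k + x * c) => //; set p := _ + _ in Jp *.
apply: (nak _ _ (par_x P)) => [|r Jr].
  split=> [|_ _ [a ->] [b ->]|a _ _ [b ->]].
  - by exists 0; rewrite mulr0.
  - by exists (a + b); rewrite mulrDr.
  - by exists (a * b); rewrite mulrCA.
have [a [d rE]] : exists a d, r = a * p + x * d.
  have [[d ->]|/par_order[u' [k' [d [uu' rE]]]]] := pselect (exists d, r = x * d).
    by exists 0, d; rewrite mul0r add0r.
  have kk' : (k <= k')%N.
    by apply: kmin; apply/asboolP; exists u', d; rewrite -rE.
  exists (u' * u^-1 * y ^+ (k' - k)), (d - u' * u^-1 * y ^+ (k' - k) * c).
  rewrite rE /p -(subnK kk') exprD addnK.
  transitivity (u' * (u^-1 * u) * (y ^+ (k' - k) * y ^+ k) + x * d); last ring.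
  by rewrite mulVr // mulr1.
exists d.
  apply: Jx; rewrite (_ : x * d = r - a * p); last by rewrite rE addrAC subrr add0r.
  by apply: (submodB (setT_subring R) Jmod) => //; exact: (submodM Jmod).
by exists a; rewrite rE addrK mulrC.
Qed.

(** The elements carried into (f, g) by some power of [x] form an ideal to which [par_principal]
    applies; its generator divides [f] and [g], hence is a unit. *)
Lemma par_primary (f g : R) : relatively_prime f g -> g != 0 ->
  exists k a b, x ^+ k = a * f + b * g.
Proof.
move=> cofg g0.
pose J := [set r | exists k a b, x ^+ k * r = a * f + b * g].
have [||||p [k [a [b pE]]] pdvd] := @par_principal J g.
- split=> [|r s [k [a [b rE]]] [l [c [d sE]]]|c r _ [k [a [b rE]]]].
  + by exists 0%N, 0, 0; rewrite mulr0 !mul0r addr0.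
  + exists (k + l)%N, (x ^+ l * a + x ^+ k * c), (x ^+ l * b + x ^+ k * d).
    transitivity (x ^+ l * (x ^+ k * r) + x ^+ k * (x ^+ l * s)); first by rewrite exprD; ring.
    by rewrite rE sE; ring.
  + by exists k, (c * a), (c * b); rewrite mulrCA rE; ring.
- by move=> r [k [a [b rE]]]; exists k.+1, a, b; rewrite exprSr -mulrA.
- by exists 0%N, 0, 1; rewrite !mul1r mul0r add0r.
- by [].
have pu : p \is a GRing.unit.
  apply: cofg; apply: pdvd; exists 0%N.
    by exists 1, 0; rewrite !mul1r mul0r addr0.
  by exists 0, 1; rewrite !mul1r mul0r add0r.
exists k, (p^-1 * a), (p^-1 * b).
by rewrite -!mulrA -mulrDr -pE mulrCA mulVr ?mulr1.
Qed.

(** If [x] does not divide [g], the colon ideal (g : f) is principal by [par_prime] and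
    [par_principal]. With generator [p] and [g = p * h], the factor [h] divides [f] too, so it is a
    unit. If [x] divides [g], it does not divide [f], and the roles are exchanged. *)
Lemma par_regular (f g a b : R) : relatively_prime f g -> f != 0 -> g != 0 ->
  f * a = g * b -> exists c, a = g * c.
Proof.
have main (f' g' a' b' : R) : relatively_prime f' g' -> g' != 0 ->
    ~ (exists c, g' = x * c) -> f' * a' = g' * b' -> exists c, a' = g' * c.
  move=> cofg g0 xg fa.
  pose J := [set r | exists s, f' * r = g' * s].
  have [||||p [q pq] pdvd] := @par_principal J g'.
  - split=> [|r s [c rE] [d sE]|c r _ [d rE]].
    + by exists 0; rewrite !mulr0.
    + by exists (c + d); rewrite !mulrDr rE sE.
    + by exists (c * d); rewrite mulrCA rE mulrCA.
  - move=> r [s rE].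
    have [/xg//|[d sE]] : (exists d, g' = x * d) \/ exists d, s = x * d.
      by apply: (@par_prime _ _ (f' * r)); rewrite -rE mulrCA.
    by exists d; apply: (mulfI x0); rewrite mulrCA rE sE mulrCA.
  - by exists f'; rewrite mulrC.
  - by [].
  have [h gE] : exists h, g' = p * h by apply: pdvd; exists f'; rewrite mulrC.
  have p0 : p != 0 by apply: contra_neq g0; rewrite gE => ->; rewrite mul0r.
  have hu : h \is a GRing.unit.
    apply: cofg; last by exists p; rewrite mulrC.
    by exists q; apply: (mulfI p0); rewrite mulrC pq gE mulrA.
  have [c ->] : exists c, a' = p * c by apply: pdvd; exists b'.
  by exists (h^-1 * c); rewrite gE -mulrA [h * _]mulrA mulrV // mul1r.
move=> cofg f0 g0 fa.
have [[c gE]|xg] := pselect (exists c, g = x * c); last exact: main fa.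
have xf : ~ exists c, f = x * c.
  move=> xf; apply: (par_nonunit P (par_x P)); apply: cofg => //; by exists c.
have [d bE] : exists d, b = f * d by apply: (main g f b a) => //; exact: relatively_primeC.
by exists d; apply: (mulfI f0); rewrite fa bE mulrCA.
Qed.

End RegularLocal.

Lemma params_sym (R : idomainType) (m : set R) (x y : R) : params m x y -> params m y x.
Proof.
case=> H1 H2 H3 H4; split=> // u; rewrite H2.
by split=> -[a [b ->]]; exists b, a; rewrite addrC.
Qed.

Lemma regular_params (R : idomainType) (m : set R) : regular_local_ring m 2 ->
  exists x y, [/\ params m x y, x != 0, y != 0,
    forall k c, y ^+ k <> x * c & forall k c, x ^+ k <> y * c].
Proof.
move=> [Rnoeth Rlocal [Rdim _] [s ms]].
have mE : forall u, m u <-> exists a b, u = a * s`_0 + b * s`_1.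
  move=> u; rewrite ms ideal_genP size_tuple; split=> [[a ->]|[a [b ->]]].
    by exists (a 0%N), (a 1%N); rewrite !big_ord_recl big_ord0 addr0.
  by exists (fun i => if i == 0%N then a else b); rewrite !big_ord_recl big_ord0 addr0.
have Pxy : params m s`_0 s`_1.
  split=> //; first exact: noetherian_seq (setT_subring R) Rnoeth.
    by case: Rlocal => -[].
  by move=> u; exact: local_unit.
have Pyx := params_sym Pxy.
have yx k c := @par_not_pow R m s`_0 s`_1 Pxy k c Rdim.
have xy k c := @par_not_pow R m s`_1 s`_0 Pyx k c Rdim.
exists s`_0, s`_1; split=> //; apply/eqP => s0.
  by apply: (@xy 1%N 0); rewrite s0 expr1 mulr0.
by apply: (@yx 1%N 0); rewrite s0 expr1 mulr0.
Qed.

(** * Valuation rings *)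

Lemma eventually_all (Q : nat -> nat -> Prop) r :
  (forall i, (i < r)%N -> exists n0, forall n, (n0 <= n)%N -> Q i n) ->
  exists n0, forall n i, (n0 <= n)%N -> (i < r)%N -> Q i n.
Proof.
elim: r => [|r IHr] ev; first by exists 0%N.
have [n1 n1P] := IHr (fun i ir => ev i (ltnW ir)).
have [n2 n2P] := ev r (ltnSn r).
exists (maxn n1 n2) => n i; rewrite geq_max => /andP[le1 le2].
by rewrite ltnS leq_eqVlt => /orP[/eqP->|]; [exact: n2P|exact: n1P].
Qed.

Section ValuationRings.
Variable L : fieldType.
Implicit Types V W : set L.

Lemma is_subringP V : is_subring V <-> subring_set V.
Proof.
split=> [[V1 VB VM]|[V1 VB VM]]; split=> [|a b Va Vb|a b Va Vb].
- exact: (set_mem V1).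
- by apply: set_mem; apply: VB; exact: mem_set.
- by apply: set_mem; apply: VM; exact: mem_set.
- exact: mem_set.
- by apply: mem_set; apply: VB; exact: set_mem.
- by apply: mem_set; apply: VM; exact: set_mem.
Qed.

(** Zero is listed apart because [0^-1 = 0] belongs to [V]. *)
Definition nonunits V : set L := [set u | V u /\ (u = 0 \/ ~ V u^-1)].

Section Valuation.
Variable V : set L.
Hypothesis Vval : is_valuation_ring V.

Lemma valring_subring : subring_set V.
Proof. by apply/is_subringP; case: Vval. Qed.

Let Vring := valring_subring.

Lemma valring_total u : ~ V u -> V u^-1.
Proof.
have [->|u0] := eqVneq u 0; first by case; exact: (subring0 Vring).
by case: Vval => _ /(_ u u0)[].
Qed.

Lemma nonunits_submodule : submodule V (nonunits V).
Proof.
have nuM a b : V a -> nonunits V b -> nonunits V (a * b).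
  move=> Va [Vb b0]; split; first exact: (subringM Vring).
  have [->|a0] := eqVneq a 0; first by left; rewrite mul0r.
  case: b0 => [->|nVb]; first by left; rewrite mulr0.
  right=> Vab; apply: nVb; rewrite (_ : b^-1 = a * (a * b)^-1).
    exact: (subringM Vring).
  by rewrite invfM mulrA divff ?mul1r.
split=> // [|a b nua nub].
  by split; [exact: (subring0 Vring)|left].
have main c d : nonunits V c -> V d -> nonunits V (c + c * d).
  move=> nuc Vd; rewrite -[X in X + _]mulr1 -mulrDr mulrC; apply: nuM => //.
  by apply: (subringD Vring) => //; exact: (subring1 Vring).
have [->|a0] := eqVneq a 0; first by rewrite add0r.
have [Vba|/valring_total Vab] := pselect (V (b / a)).
  by have := main a _ nua Vba; rewrite [a * _]mulrC divfK.
rewrite invf_div in Vab; have [->|b0] := eqVneq b 0; first by rewrite addr0.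
by have := main b _ nub Vab; rewrite [b * _]mulrC divfK // addrC.
Qed.

Lemma nonunits_local : is_local_ring V (nonunits V).
Proof.
have max J : is_ideal V J -> ~ J 1 -> J `<=` nonunits V.
  move=> [JV J0 JD JM] J1 u Ju; split; first exact: JV.
  have [->|u0] := eqVneq u 0; [by left|right=> Vu].
  by apply: J1; rewrite -(mulVf u0); exact: JM.
have nu1 : ~ nonunits V 1.
  by case=> _ [/eqP|]; rewrite ?oner_eq0 // invr1; apply; exact: (subring1 Vring).
have nuideal : is_ideal V (nonunits V).
  by apply/is_idealP; split; [exact: nonunits_submodule|move=> u []].
split.
  split=> // J Jideal nuJ; have [J1|nJ1] := pselect (J 1); [right|left].
    case: Jideal => JV _ _ JM; apply/seteqP; split=> // u Vu.
    by rewrite -[u]mulr1; exact: JM.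
  by apply/seteqP; split=> //; exact: max.
move=> N [Nideal N1 Nmax]; have [<-//|nuV] := Nmax _ nuideal (max _ Nideal N1).
by case: nu1; rewrite nuV; exact: (subring1 Vring).
Qed.

Lemma valring_integral w d (a : nat -> L) : (forall i, V (a i)) ->
  w ^+ d = \sum_(j < d) a j * w ^+ j -> V w.
Proof.
move=> Va wd; apply: contrapT => nVw; apply: (nVw).
have w0 : w != 0 by apply/eqP => w0; apply: nVw; rewrite w0; exact: (subring0 Vring).
case: d wd => [/eqP|d wd]; first by rewrite big_ord0 expr0 oner_eq0.
have -> : w = \sum_(j < d.+1) a j * w^-1 ^+ (d - j).
  apply: (mulIf (expf_neq0 d w0)); rewrite -exprS wd mulr_suml; apply: eq_bigr => j _.
  have jd : (j <= d)%N by rewrite -ltnS.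
  have -> : w ^+ d = w ^+ (d - j) * w ^+ j by rewrite -exprD subnK.
  by rewrite -mulrA; congr (_ * _); rewrite mulrA exprVn mulVf ?mul1r ?expf_neq0.
apply: (subring_sum Vring) => j _; apply: (subringM Vring) => //.
by apply: (subringX Vring); exact: valring_total.
Qed.

(* The value [n] of [t] is characterized by [t / p ^ n] being a unit, where
   [p] generates the maximal ideal. *)
Lemma noeth_valring_DVR : noeth_seq V -> ~ is_field V -> is_DVR V.
Proof.
move=> Vnoeth /existsNP[g0 /not_implyP[Vg0 /not_implyP[g00 nVg0]]].
pose pos u := [/\ V u, u != 0 & ~ V u^-1].
(* Without such a [p], repeated choice gives an infinite strictly ascending chain of principal
   ideals. *)
have [p [Vp p0 nVp] pmin] : exists2 p, pos p & forall u, pos u -> V (u / p).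
  apply: contrapT => nop.
  have /choice[h hP] : forall u, exists u', pos u -> pos u' /\ ~ V (u' / u).
    move=> u; have [pu|npu] := pselect (pos u); last by exists u.
    apply: contrapT => nou; apply: nop; exists u => // u' pu'; apply: contrapT => Vu'.
    by apply: nou; exists u'.
  pose u n := iter n h g0.
  have pu n : pos (u n) by elim: n => [//|n IHn]; case: (hP _ IHn).
  have uV i j : V (u i / u (i + j)%N).
    elim: j => [|j IHj].
      by rewrite addn0 divff; [exact: (subring1 Vring)|case: (pu i)].
    have [_ /valring_total] := hP _ (pu (i + j)%N); rewrite invf_div => Vstep.
    have [_ uij0 _] := pu (i + j)%N.
    have -> : u i / u (i + j.+1)%N = u i / u (i + j)%N * (u (i + j)%N / u (i + j).+1).
      by rewrite addnS mulrA divfK.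
    exact: (subringM Vring).
  have Vu i : V (u i) by case: (pu i).
  have [n [a [Va un]]] := Vnoeth u Vu.
  case: n un => [|n] un; first by case: (pu 0%N) => _ /eqP + _; rewrite un big_ord0.
  have [_] := hP _ (pu n); apply; rewrite -[h _]/(u n.+1) un mulr_suml.
  apply: (subring_sum Vring) => i _; rewrite -mulrA; apply: (subringM Vring) => //.
  have in_ : (i <= n)%N by rewrite -ltnS.
  by have := uV i (n - i)%N; rewrite subnKC.
have npow n : ~ V (p ^+ n.+1)^-1.
  move=> Vpn; apply: nVp; rewrite (_ : p^-1 = p ^+ n * (p ^+ n.+1)^-1).
    by apply: (subringM Vring) => //; exact: (subringX Vring).
  by rewrite exprS invfM mulrCA divff ?mulr1 // expf_neq0.
(* If all powers of [p] divided [t], a linear relation among the [t / p ^+ i] would put [p^-1] in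
   [V]. *)
have Vexp t : V t -> t != 0 -> exists n, ~ V (t / p ^+ n).
  move=> Vt t0; apply: contrapT => /forallNP allV.
  have allV' i : V (t / p ^+ i) by apply: contrapT; exact: allV.
  have [k [a [Va tk]]] := Vnoeth _ allV'.
  apply: nVp; rewrite (_ : p^-1 = \sum_(i < k) a i * p ^+ (k - i).-1).
    apply: (subring_sum Vring) => i _; apply: (subringM Vring) => //.
    exact: (subringX Vring).
  apply: (mulfI (mulf_neq0 t0 (invr_neq0 (expf_neq0 k p0)))).
  rewrite {1}tk mulr_suml mulr_sumr; apply: eq_bigr => i _.
  have ik : (i < k)%N by [].
  have -> : p ^+ k = p ^+ (k - i).-1 * p * p ^+ i.
    by rewrite -exprSr prednK ?subn_gt0 // -exprD subnK // ltnW.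
  have [pi0 pk0] : p ^+ i != 0 /\ p ^+ (k - i).-1 != 0 by rewrite !expf_neq0.
  by field; rewrite p0 pi0 pk0.
have vex t : exists n : int, t != 0 -> V (t / p ^ n) /\ V (t / p ^ n)^-1.
  have [->|t0] := eqVneq t 0; first by exists 0.
  have pos_case s : V s -> s != 0 ->
      exists n : nat, V (s / p ^+ n) /\ V (s / p ^+ n)^-1.
    move=> Vs s0; have exn : exists n, `[< ~ V (s / p ^+ n) >].
      by have [n ?] := Vexp _ Vs s0; exists n; apply/asboolP.
    case: (ex_minnP exn) => -[|n] /asboolP nVn nmin.
      by case: nVn; rewrite expr0 divr1.
    exists n; have Vn : V (s / p ^+ n).
      apply: contrapT => nVn'; have := nmin n (asboolT nVn'); by rewrite ltnn.
    split=> //; apply: contrapT => nVn'; apply: nVn.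
    rewrite exprSr invfM mulrA; apply: pmin; split=> //.
    by rewrite mulf_neq0 ?invr_neq0 ?expf_neq0.
  have [Vt|/valring_total Vt] := pselect (V t).
    by have [n ?] := pos_case t Vt t0; exists n%:Z.
  have [n [Vn Vn']] := pos_case _ Vt (invr_neq0 t0); exists (- n%:Z) => _.
  have E : (t^-1 / p ^+ n)^-1 = t / p ^ (- n%:Z).
    by rewrite invfM invrK -invr_expz !invrK.
  by rewrite -E invrK.
have [v vP] := choice vex.
have pz0 n : p ^ n != 0 by rewrite expfz_neq0.
have le_exp t (a b : int) : t != 0 -> V (t / p ^ a) -> V (t / p ^ b)^-1 -> a <= b.
  move=> t0 Va Vb; rewrite leNgt; apply/negP => ab.
  have [n abn] : exists n : nat, b = a - n.+1%:Z by exists (`|a - b|.-1)%N; lia.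
  apply: (npow n); rewrite (_ : _^-1 = (t / p ^ a) * (t / p ^ b)^-1).
    exact: (subringM Vring).
  have -> : p ^ b = p ^ a / p ^+ n.+1 by rewrite abn expfzDr // -invr_expz.
  by field; rewrite t0 pz0 expf_neq0.
have v_uniq t n : t != 0 -> V (t / p ^ n) -> V (t / p ^ n)^-1 -> v t = n.
  move=> t0 Vn Vn'; have [Vv Vv'] := vP t t0.
  by apply/eqP; rewrite eq_le (le_exp t) // (le_exp t).
have vM a b : a != 0 -> b != 0 -> v (a * b) = v a + v b.
  move=> a0 b0; have [Va Va'] := vP a a0; have [Vb Vb'] := vP b b0.
  have E : a * b / p ^ (v a + v b) = (a / p ^ v a) * (b / p ^ v b).
    by rewrite expfzDr // invfM mulrACA.
  apply: v_uniq; rewrite ?mulf_neq0 // E; first exact: (subringM Vring).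
  by rewrite invfM; apply: (subringM Vring).
have vp n : v (p ^ n) = n.
  apply: v_uniq => //; rewrite divff // ?invr1; exact: (subring1 Vring).
have VE a : V a <-> a = 0 \/ 0 <= v a.
  have [->|a0] := eqVneq a 0.
    by split=> _; [left|exact: (subring0 Vring)].
  have [Va Va'] := vP a a0; split=> [Vaa|].
    by right; apply: (le_exp a) => //; rewrite expr0z divr1.
  case=> [/eqP|va]; first by rewrite (negbTE a0).
  rewrite -[a](divfK (pz0 (v a))); apply: (subringM Vring) => //.
  by case: (v a) va => // n _; exact: (subringX Vring).
exists v; split=> [a b|a b a0 b0 ab0|n|].
- by rewrite !inE => a0 b0; rewrite vM.
- set n := Num.min _ _.
  have shift c : c != 0 -> n <= v c -> V (c / p ^ n).
    move=> c0 nc; apply/VE; right.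
    by rewrite vM ?invr_neq0 // invr_expz vp subr_ge0.
  have : V ((a + b) / p ^ n).
    rewrite mulrDl; apply: (subringD Vring); apply: shift => //.
      by rewrite /n ge_min lexx.
    by rewrite /n ge_min lexx orbT.
  case/VE => [/eqP|]; first by rewrite mulf_eq0 invr_eq0 (negbTE ab0) (negbTE (pz0 n)).
  by rewrite vM ?invr_neq0 // invr_expz vp subr_ge0.
- by exists (p ^ n).
- by apply/seteqP; split=> a /VE.
Qed.

End Valuation.

(** The body of [is_DVR] with the valuation exposed, so that [is_DVR V] is convertible to
    [exists v, valuation_of V v]. *)
Definition valuation_of V (v : L -> int) :=
  [/\ {in [pred x : L | x != 0] &, {morph v : x y / x * y >-> x + y}},
      forall x y : L, x != 0 -> y != 0 -> x + y != 0 -> Num.min (v x) (v y) <= v (x + y),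
      forall n, exists2 x : L, x != 0 & v x = n
    & V = [set x | x = 0 \/ 0 <= v x]].

Section DVR.
Variables (V : set L) (v : L -> int).
Hypothesis vV : valuation_of V v.

Lemma valM a b : a != 0 -> b != 0 -> v (a * b) = v a + v b.
Proof. by case: vV => + _ _ _ a0 b0; apply. Qed.

Lemma valD a b : a != 0 -> b != 0 -> a + b != 0 -> Num.min (v a) (v b) <= v (a + b).
Proof. by case: vV => _ + _ _; apply. Qed.

Lemma valE a : V a <-> a = 0 \/ 0 <= v a.
Proof. by case: vV => _ _ _ ->. Qed.

Lemma valE0 a : a != 0 -> V a <-> 0 <= v a.
Proof. by move=> a0; rewrite valE; split=> [[/eqP|//]|]; [rewrite (negbTE a0)|right]. Qed.

Lemma val1 : v 1 = 0.
Proof. by apply: (addrI (v 1)); rewrite -valM ?oner_neq0 // mulr1 addr0. Qed.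

Lemma valV a : a != 0 -> v a^-1 = - v a.
Proof.
move=> a0; apply: (addrI (v a)).
by rewrite -valM ?invr_eq0 // divff // val1 subrr.
Qed.

Lemma valX a n : a != 0 -> v (a ^+ n) = v a *+ n.
Proof.
move=> a0; elim: n => [|n IHn]; first by rewrite val1 mulr0n.
by rewrite exprS valM ?expf_neq0 // IHn mulrS.
Qed.

Lemma valN a : a != 0 -> v (- a) = v a.
Proof.
move=> a0; have n1 : (-1 : L) != 0 by rewrite oppr_eq0 oner_neq0.
have : v (-1) + v (-1) = 0 by rewrite -valM // mulN1r opprK val1.
by move=> vv; rewrite -mulN1r valM //; lia.
Qed.

Lemma DVR_valring : is_valuation_ring V.
Proof.
have V1 : V 1 by apply/valE0; rewrite ?oner_neq0 // val1.
have VN a : V a -> V (- a).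
  have [->|a0] := eqVneq a 0; first by rewrite oppr0.
  by move=> /(valE0 a0) va; apply/valE0; rewrite ?oppr_eq0 // valN.
split=> [|a a0].
  apply/is_subringP; split=> // [a b Va /VN Vb|a b].
    have [->|a0] := eqVneq a 0; first by rewrite add0r.
    have [->|b0] := eqVneq (- b) 0; first by rewrite addr0.
    have [->|ab0] := eqVneq (a - b) 0; first by apply/valE; left.
    apply/(valE0 ab0); apply: le_trans (valD a0 b0 ab0).
    by rewrite le_min; apply/andP; split; exact/valE0.
  have [->|a0] := eqVneq a 0; first by rewrite mul0r.
  have [->|b0] := eqVneq b 0; first by rewrite mulr0.
  move=> /(valE0 a0) va /(valE0 b0) vb; apply/valE0; first by rewrite mulf_neq0.
  by rewrite valM // addr_ge0.
have [va|va] := leP 0 (v a); first by left; exact/valE0.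
by right; apply/valE0; rewrite ?invr_eq0 // valV // oppr_ge0 ltW.
Qed.

Lemma DVR_not_field : ~ is_field V.
Proof.
case: (vV) => _ _ /(_ 1)[p p0 vp] _ /(_ p).
have Vp : V p by apply/valE0; rewrite ?vp.
by move=> /(_ Vp p0)/valE0; rewrite invr_eq0 valV // vp => /(_ p0).
Qed.

Lemma DVR_noetherian : noetherian V.
Proof.
have Vring := valring_subring DVR_valring.
move=> J [JV J0 JD JM].
have gen (s : seq L) : [set` s] `<=` J -> is_ideal V (ideal_gen V [set` s]).
  by move=> sJ; apply: ideal_gen_is_ideal => // u /sJ/JV.
have [[w Jw w0]|noJ] := pselect (exists2 u, J u & u != 0); last first.
  exists [::]; split=> //; apply/seteqP; split=> u.
    move=> Ju; have [->|u0] := eqVneq u 0; last by case: noJ; exists u.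
    by case: (gen [::]).
  by apply: smallest_sub.
pose ok n := `[< exists u, [/\ J u, u != 0 & v u = n%:Z] >].
have exok : exists n, ok n.
  exists `|v w|%N; apply/asboolP; exists w; split=> //.
  by have := (valE0 w0).1 (JV _ Jw); lia.
case: (ex_minnP exok) => n /asboolP[p [Jp p0 vp]] nmin.
have pJ : [set` [:: p]] `<=` J by move=> u; rewrite /= inE => /eqP->.
exists [:: p]; split=> //; apply/seteqP; split=> u; last by apply: smallest_sub.
move=> Ju; have /is_idealP[pmod _] := gen _ pJ.
have [->|u0] := eqVneq u 0; first exact: submod0 pmod.
rewrite -[u](divfK p0); apply: (submodM pmod); last first.
  by apply: sub_gen_smallest; rewrite /= inE.
apply/valE0; first by rewrite mulf_neq0 ?invr_eq0.
rewrite valM ?invr_eq0 // valV // subr_ge0 vp.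
have vu := (valE0 u0).1 (JV _ Ju).
have /nmin : ok `|v u|%N by apply/asboolP; exists u; split=> //; lia.
by lia.
Qed.

Lemma val_add1 a : a != 0 -> 0 < v a -> 1 + a != 0 /\ v (1 + a) = 0.
Proof.
move=> a0 va; have a10 : 1 + a != 0.
  apply: contraTneq va => /eqP; rewrite addrC addr_eq0 => /eqP ->.
  by rewrite valN ?oner_neq0 // val1.
split=> //; have := valD (oner_neq0 L) a0 a10; rewrite val1 min_l ?(ltW va) // => le1.
have := @valD (1 + a) (- a) a10; rewrite oppr_eq0 addrK valN // oner_neq0 val1.
move=> /(_ a0 isT); rewrite ge_min => /orP[le2|]; last by rewrite leNgt va.
by apply/eqP; rewrite eq_le le1 le2.
Qed.

(** Unlike [nonunits], this leaves out [0], so that membership amounts to a strict inequality for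
    the valuation. *)
Definition in_max V a := V a /\ ~ V a^-1.

Lemma in_maxE a : in_max V a <-> a != 0 /\ 0 < v a.
Proof.
have V0 : V 0 by apply/valE; left.
split=> [[Va nVa]|[a0 va]].
  have a0 : a != 0 by apply/eqP => a0; apply: nVa; rewrite a0 invr0.
  split=> //; rewrite ltNge; apply/negP => va; apply: nVa; apply/valE0.
    by rewrite invr_eq0.
  by rewrite valV // oppr_ge0.
split; first by apply/valE0 => //; exact: ltW.
by move/valE0; rewrite invr_eq0 a0 valV // => /(_ isT); lia.
Qed.

Lemma not_inE a : ~ V a <-> a != 0 /\ v a < 0.
Proof.
have V0 : V 0 by apply/valE; left.
split=> [nVa|[a0 va] /(valE0 a0)]; last by lia.
have a0 : a != 0 by apply/eqP => a0; apply: nVa; rewrite a0.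
by split=> //; rewrite ltNge; apply/negP => va; apply: nVa; exact/valE0.
Qed.

(* A discrete valuation ring is a maximal proper subring of [L]. *)
Lemma DVR_maximal (W : set L) a : subring_set W -> V `<=` W -> W a -> ~ V a ->
  forall c, W c.
Proof.
move=> Wring VW Wa /not_inE[a0 va] c.
have [->|c0] := eqVneq c 0; first exact: (subring0 Wring).
rewrite -(divfK (expf_neq0 `|v c|%N a0) c); apply: (subringM Wring); last exact: (subringX Wring).
apply: VW; apply/valE0; first by rewrite mulf_neq0 ?invr_neq0 ?expf_neq0.
rewrite valM ?invr_neq0 ?expf_neq0 // valV ?expf_neq0 // valX // -mulr_natr.
by nia.
Qed.

End DVR.
End ValuationRings.

(** * Approximation for discrete valuation rings and existence of valuation rings *)

Section Approximation.
Variable L : fieldType.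
Implicit Types V W : set L.

Lemma DVR_approximation V0 (W : nat -> set L) r : is_DVR V0 ->
  (forall i, (i < r)%N -> is_DVR (W i) /\ W i <> V0) ->
  exists a, ~ V0 a /\ forall i, (i < r)%N -> in_max (W i) a.
Proof.
move=> [v0 v0P]; have v0V : valuation_of V0 v0 by [].
elim: r => [|r IHr] WP.
  have [_ _ /(_ (-1))[a a0 va] _] := v0P.
  by exists a; split=> //; apply/(not_inE v0V); rewrite va.
have [a [nV0a Wa]] := IHr (fun i ir => WP i (ltnW ir)).
have [[w wP] Wr_neq] := WP r (ltnSn r).
have wV : valuation_of (W r) w by [].
(* Two distinct discrete valuation rings are incomparable by [DVR_maximal]; [b] is a quotient of an
   element of [W r] outside [V0] by an element of [V0] outside [W r]. *)
have [b [nV0b Wb]] : exists b, ~ V0 b /\ in_max (W r) b.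
  have nsub (A B : set L) v v' : valuation_of A v -> valuation_of B v' -> A <> B ->
      exists2 c, A c & ~ B c.
    move=> Av Bv' AB; apply: contrapT => nAB; apply: AB.
    have sub : A `<=` B by move=> c Ac; apply: contrapT => nBc; apply: nAB; exists c.
    apply/seteqP; split=> // c Bc; apply: contrapT => nAc.
    have allB := DVR_maximal Av (valring_subring (DVR_valring Bv')) sub Bc nAc.
    by apply: (DVR_not_field Bv') => d _ _; exact: allB.
  have [c Wc nVc] := nsub _ _ _ _ wV v0V Wr_neq.
  have [d Vd nWd] := nsub _ _ _ _ v0V wV (nesym Wr_neq).
  have [c0 vc] := (not_inE v0V c).1 nVc; have [d0 wd] := (not_inE wV d).1 nWd.
  have vd := (valE0 v0V d0).1 Vd; have wc := (valE0 wV c0).1 Wc.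
  exists (c / d); split.
    apply/(not_inE v0V); split; first by rewrite mulf_neq0 ?invr_eq0.
    by rewrite (valM v0V) ?invr_eq0 // (valV v0V) //; lia.
  apply/(in_maxE wV); split; first by rewrite mulf_neq0 ?invr_eq0.
  by rewrite (valM wV) ?invr_eq0 // (valV wV) //; lia.
have [a0 va] := (not_inE v0V a).1 nV0a; have [b0 vb] := (not_inE v0V b).1 nV0b.
have [_ wb] := (in_maxE wV b).1 Wb.
have [n0 n0P] : exists n0, forall n i, (n0 <= n)%N -> (i < r)%N ->
    in_max (W i) (a ^+ n * b) /\ in_max (W i) (a ^+ n.+1).
  apply: eventually_all => i ir; have [[v vP] _] := WP i (ltnW ir).
  have vV : valuation_of (W i) v by [].
  have [_ va_pos] := (in_maxE vV a).1 (Wa i ir).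
  exists (`|v b|.+1)%N => n nb; split; apply/(in_maxE vV); split.
  - by rewrite mulf_neq0 ?expf_neq0.
  - by rewrite (valM vV) ?expf_neq0 // (valX vV) // -mulr_natr; nia.
  - by rewrite expf_neq0.
  - by rewrite (valX vV) // -mulr_natr; nia.
have [wa|wa] := leP 0 (w a); last first.
  (* [1 / (1 + a ^- n)] is near 1 where [a] has a pole, near 0 where it vanishes *)
  have key v V n : valuation_of V v -> v a < 0 -> 
      1 + a^-1 ^+ n.+1 != 0 /\ v (1 + a^-1 ^+ n.+1) = 0.
    move=> vV va'; apply: (val_add1 vV); first by rewrite expf_neq0 ?invr_eq0.
    by rewrite (valX vV) ?invr_eq0 // (valV vV) // -mulr_natr; nia.
  have [e0 ve] := key v0 V0 n0 v0V va; have [_ we] := key w (W r) n0 wV wa.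
  exists (b / (1 + a^-1 ^+ n0.+1)); split.
    apply/(not_inE v0V); split; first by rewrite mulf_neq0 ?invr_eq0.
    by rewrite (valM v0V) ?invr_eq0 // (valV v0V) // ve subr0.
  move=> i; rewrite ltnS leq_eqVlt => /orP[/eqP->|ir].
    apply/(in_maxE wV); split; first by rewrite mulf_neq0 ?invr_eq0.
    by rewrite (valM wV) ?invr_eq0 // (valV wV) // we subr0.
  have [[v vP] _] := WP i (ltnW ir); have vV : valuation_of (W i) v by [].
  have [Wn _] := n0P n0.+1 i (leqnSn _) ir; have [_ Wn1] := n0P n0 i (leqnn _) ir.
  have [_ vn] := (in_maxE vV _).1 Wn; have [an0 vn1] := (in_maxE vV _).1 Wn1.
  have [f0 vf] := val_add1 vV an0 vn1.
  have -> : b / (1 + a^-1 ^+ n0.+1) = a ^+ n0.+1 * b / (1 + a ^+ n0.+1).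
    have -> : 1 + a^-1 ^+ n0.+1 = (1 + a ^+ n0.+1) / a ^+ n0.+1.
      by rewrite exprVn mulrDl divff // mul1r addrC.
    by rewrite invf_div mulrA [b * _]mulrC.
  apply/(in_maxE vV); split; first by rewrite !mulf_neq0 ?invr_eq0.
  by rewrite (valM vV) ?mulf_neq0 ?invr_eq0 // (valV vV) // vf subr0.
exists (a ^+ n0.+1 * b); split.
  apply/(not_inE v0V); split; first by rewrite mulf_neq0 ?expf_neq0.
  by rewrite (valM v0V) ?expf_neq0 // (valX v0V) // -mulr_natr; nia.
move=> i; rewrite ltnS leq_eqVlt => /orP[/eqP->|ir].
  apply/(in_maxE wV); split; first by rewrite mulf_neq0 ?expf_neq0.
  by rewrite (valM wV) ?expf_neq0 // (valX wV) // -mulr_natr; nia.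
by have [] := n0P n0.+1 i (leqnSn _) ir.
Qed.

(** With [a] from [DVR_approximation], the element [1 / (1 + a ^- n)] is a unit at [V0], where [a]
    has a pole, and equals [a ^+ n / (1 + a ^+ n)], which for large [n] is divisible by [g] in every
    [W i]. *)
Lemma DVR_indicator V0 (W : nat -> set L) r g : is_DVR V0 -> in_max V0 g ->
  (forall i, (i < r)%N -> [/\ is_DVR (W i), W i <> V0 & in_max (W i) g]) ->
  exists e, [/\ V0 e, ~ V0 (e / g) & forall i, (i < r)%N -> W i (e / g)].
Proof.
move=> V0dvr g_in WP.
have [|a [nVa Wa]] := @DVR_approximation V0 W r V0dvr.
  by move=> i /WP[].
have [v0 v0V] := V0dvr; have {}v0V : valuation_of V0 v0 by [].
have [a0 va] := (not_inE v0V a).1 nVa; have [g0 vg] := (in_maxE v0V g).1 g_in.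
have [n0 n0P] : exists n0, forall n i, (n0 <= n)%N -> (i < r)%N ->
    in_max (W i) (a ^+ n.+1) /\ in_max (W i) (a ^+ n.+1 / g).
  apply: eventually_all => i ir; have [[w wP] _ _] := WP i ir.
  have wV : valuation_of (W i) w by [].
  have [_ wa] := (in_maxE wV a).1 (Wa i ir).
  exists `|w g|%N => j nj; split; apply/(in_maxE wV); split.
  - by rewrite expf_neq0.
  - by rewrite (valX wV) // -mulr_natr; nia.
  - by rewrite mulf_neq0 ?invr_eq0 ?expf_neq0.
  - by rewrite (valM wV) ?invr_eq0 ?expf_neq0 // (valV wV) // (valX wV) // -mulr_natr; nia.
have an0 : a ^+ n0.+1 != 0 by rewrite expf_neq0.
have [d0 vd] : 1 + a^-1 ^+ n0.+1 != 0 /\ v0 (1 + a^-1 ^+ n0.+1) = 0.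
  apply: (val_add1 v0V); first by rewrite expf_neq0 ?invr_eq0.
  by rewrite (valX v0V) ?invr_eq0 // (valV v0V) // -mulr_natr; nia.
have ve : v0 (1 + a^-1 ^+ n0.+1)^-1 = 0 by rewrite (valV v0V) // vd oppr0.
have e0 : (1 + a^-1 ^+ n0.+1)^-1 != 0 by rewrite invr_eq0.
exists (1 + a^-1 ^+ n0.+1)^-1; split.
- by apply/(valE0 v0V) => //; rewrite ve.
- apply/(not_inE v0V); split; first by rewrite mulf_neq0 ?invr_eq0.
  by rewrite (valM v0V) ?invr_eq0 // ve (valV v0V) // add0r oppr_lt0.
move=> i ir; have [Wn Wng] := n0P n0 i (leqnn _) ir.
have [[w wP] _ _] := WP i ir; have wV : valuation_of (W i) w by [].
have [_ wn] := (in_maxE wV _).1 Wn; have [f0 wf] := val_add1 wV an0 wn.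
have -> : (1 + a^-1 ^+ n0.+1)^-1 / g = a ^+ n0.+1 / g / (1 + a ^+ n0.+1).
  have -> : 1 + a^-1 ^+ n0.+1 = (1 + a ^+ n0.+1) / a ^+ n0.+1.
    by rewrite exprVn mulrDl divff // mul1r addrC.
  by rewrite invf_div mulrAC.
apply: (subringM (valring_subring (DVR_valring wV))); first by case: Wng.
by apply/(valE0 wV); rewrite ?invr_eq0 // (valV wV) // wf oppr0.
Qed.

Definition adjoin (N : set L) t : set L :=
  [set u | exists p : {poly L}, (forall i, N p`_i) /\ u = p.[t]].

Lemma adjoin_subring N t : subring_set N -> subring_set (adjoin N t).
Proof.
move=> Nring; split.
- exists 1; rewrite hornerE; split=> // i; rewrite coef1.
  by case: eqP => _; [exact: (subring1 Nring)|exact: (subring0 Nring)].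
- move=> _ _ [p [Np ->]] [q [Nq ->]]; exists (p - q); rewrite hornerD hornerN; split=> // i.
  by rewrite coefB; exact: (subringB Nring).
- move=> _ _ [p [Np ->]] [q [Nq ->]]; exists (p * q); rewrite hornerM; split=> // i.
  rewrite coefM; apply: (subring_sum Nring) => j _; exact: (subringM Nring).
Qed.

Lemma adjoin_sub N t : subring_set N -> N `<=` adjoin N t.
Proof.
move=> Nring u Nu; exists u%:P; rewrite hornerC; split=> // i; rewrite coefC.
by case: eqP => _ //; exact: (subring0 Nring).
Qed.

Lemma adjoin_mem N t : subring_set N -> adjoin N t t.
Proof.
move=> Nring; exists 'X; rewrite hornerX; split=> // i; rewrite coefX.
by case: eqP => _; [exact: (subring1 Nring)|exact: (subring0 Nring)].
Qed.

(* A subring [A] containing [w^-1] and maximal among those not containing [w]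
   is a valuation ring; [w^-1 A] lies in its Jacobson radical. *)
Lemma exists_valuation N w : subring_set N ->
  ~ (exists d (a : nat -> L), (forall i, N (a i)) /\
       w ^+ d = \sum_(j < d) a j * w ^+ j) ->
  exists V, [/\ is_valuation_ring V, N `<=` V & ~ V w].
Proof.
move=> Nring nint.
have w0 : w != 0.
  apply/eqP => w0; apply: nint; exists 1%N, (fun=> 0); split=> [_|].
    exact: (subring0 Nring).
  by rewrite big_ord1 w0 mul0r expr1.
have nNw : ~ adjoin N w^-1 w.
  move=> [p [Np wp]]; apply: nint; exists (size p).+1, (fun i => p`_(size p - i)); split=> //.
  rewrite exprSr {2}wp (horner_coef_wide _ (leqnSn _)) mulr_sumr (reindex_inj rev_ord_inj).
  apply: eq_bigr => -[i /=]; rewrite ltnS subSS => ip _.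
  have -> : w ^+ size p = w ^+ (size p - i) * w ^+ i by rewrite -exprD subnK.
  by rewrite exprVn; field; rewrite expf_neq0.
have [|||A [[Aring nAw] NA Amax]] :=
    @Zorn_above _ [set A | subring_set A /\ ~ A w] (adjoin N w^-1).
- by exists w^-1; exact: adjoin_mem.
- by split=> //; exact: adjoin_subring.
- move=> F [A0 FA0] FP _ Ftot; split; last by move=> [A FA Aw]; case: (FP A FA).
  have dir a b : (\bigcup_(X in F) X) a -> (\bigcup_(X in F) X) b ->
      exists2 X, F X & X a /\ X b.
    move=> [X FX Xa] [Y FY Yb]; have [XY|YX] := Ftot X Y FX FY.
      by exists Y => //; split=> //; exact: XY.
    by exists X => //; split=> //; exact: YX.
  split=> [|a b Fa Fb|a b Fa Fb].
  + by exists A0 => //; have [/subring1] := FP _ FA0.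
  + have [X FX [Xa Xb]] := dir a b Fa Fb; exists X => //.
    by apply: subringB => //; case: (FP X FX).
  + have [X FX [Xa Xb]] := dir a b Fa Fb; exists X => //.
    by apply: subringM => //; case: (FP X FX).
have Aw' : A w^-1 by apply: NA; exact: adjoin_mem.
have Amax' t : ~ A t -> adjoin A t w.
  move=> nAt; apply: contrapT => nAtw; apply: nAt.
  apply: (Amax (adjoin A t)); last exact: adjoin_mem.
    exact: adjoin_sub.
  by split=> //; exact: adjoin_subring.
(* Otherwise [w] lies in [A[d^-1]] by maximality, so [w * d ^+ n] is in [A] for some [n]. The
   identity [w * d ^+ n = w * d ^+ n.+1 + b * d ^+ n] then lowers [n] to [0]. *)
have Ainv b : A b -> 1 - w^-1 * b != 0 /\ A (1 - w^-1 * b)^-1.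
  move=> Ab; have d0 : 1 - w^-1 * b != 0.
    apply/eqP => /eqP; rewrite subr_eq0 => /eqP wb; apply: nAw.
    by rewrite -[w]mulr1 wb mulrA divff // mul1r.
  split=> //; set d := 1 - _ in d0 *; have Ad : A d.
    by apply: (subringB Aring); [exact: (subring1 Aring)|exact: (subringM Aring)].
  apply: contrapT => /Amax'[p [Ap wp]].
  have Awd : A (w * d ^+ size p).
    rewrite {1}wp horner_coef mulr_suml; apply: (subring_sum Aring) => i _.
    have -> : d ^+ size p = d ^+ (size p - i) * d ^+ i by rewrite -exprD subnK // ltnW.
    have -> : p`_i * d^-1 ^+ i * (d ^+ (size p - i) * d ^+ i) = p`_i * d ^+ (size p - i).
      by rewrite exprVn; field; rewrite expf_neq0.
    by apply: (subringM Aring) => //; exact: (subringX Aring).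
  elim: (size p) Awd => [|n IHn]; first by rewrite mulr1.
  move=> Awd; apply: IHn; rewrite (_ : w * d ^+ n = w * d ^+ n.+1 + b * d ^+ n).
    apply: (subringD Aring) => //; apply: (subringM Aring) => //.
    exact: (subringX Aring).
  by rewrite exprS /d; field.
(* A relation of degree at most [n] showing that [w^-1 A] generates the unit ideal of [A[t]]. If
   neither [t] nor [t^-1] is in [A], both have such relations, and those of least degree contradict
   each other. *)
pose small t n := exists p : {poly L},
  [/\ (size p <= n.+1)%N, forall i, A (w * p`_i) & 1 = p.[t]].
have smallP t : ~ A t -> exists n, small t n.
  move=> /Amax'[p [Ap wp]]; exists (size p), (w^-1 *: p).
  split=> [|i|]; first by rewrite (leq_trans (size_scale_leq _ _)).
    by rewrite coefZ mulrA divff // mul1r.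
  by rewrite hornerZ -wp mulVf.
(* The relation for [t^-1], multiplied by a power of [t], expresses [(1 - q]_0) * t ^+
   n[by lower powers; as]1 - q[_0] is invertible in [A], it eliminates the leading term of [p]. *)
have step t n l : t != 0 -> (l <= n)%N -> small t n -> small t^-1 l ->
    exists2 n', (n' < n)%N & small t n'.
  move=> t0 ln [p [pn Ap p1]] [q [ql Aq q1]].
  have [d0 Ad] := Ainv _ (Aq 0%N); rewrite mulrA mulVf // mul1r in d0 Ad.
  case: n pn ln => [|n] pn ln.
    have p01 : p`_0 = 1 by rewrite p1 [in RHS](size1_polyC pn) hornerC.
    by case: nAw; rewrite -[w]mulr1 -p01.
  exists n => //; pose c := p`_n.+1 / (1 - q`_0).
  exists (\poly_(i < n.+1) (p`_i + c * q`_(n.+1 - i))); split; first exact: size_poly.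
    move=> i; rewrite coef_poly; case: ifP => _; last by rewrite mulr0; exact: (subring0 Aring).
    rewrite mulrDr; apply: (subringD Aring) => //.
    have -> : w * (c * q`_(n.+1 - i))
       = w^-1 * (w * p`_n.+1) * (1 - q`_0)^-1 * (w * q`_(n.+1 - i)).
      by rewrite /c; field; rewrite d0 w0.
    exact: (subringM Aring (subringM Aring (subringM Aring Aw' (Ap _)) Ad) (Aq _)).
  have qsum : \sum_(i < n.+1) q`_(n.+1 - i) * t ^+ i = (1 - q`_0) * t ^+ n.+1.
    rewrite {1}q1 (horner_coef_wide _ (leq_trans ql (ln : (l < n.+2)%N))) [in RHS]big_ord_recl.
    rewrite expr0 mulr1 [in RHS]addrAC subrr add0r mulr_suml (reindex_inj rev_ord_inj).
    apply: eq_bigr => -[i /=]; rewrite ltnS subSS => i_n _.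
    have -> : t ^+ n.+1 = t ^+ (n - i) * t ^+ i.+1 by rewrite -exprD addnS subnK.
    rewrite /bump add1n subSn ?leq_subr // subKn // exprVn.
    by field; rewrite expf_neq0.
  rewrite horner_poly; under eq_bigr do rewrite mulrDl -mulrA.
  rewrite big_split -mulr_sumr /= qsum mulrA divfK // {1}p1.
  by rewrite (horner_coef_wide _ pn) big_ord_recr.
exists A; split=> //; last by move=> u Nu; apply: NA; exact: adjoin_sub.
split; first exact/is_subringP.
move=> t t0; apply: contrapT => /not_orP[nAt nAt'].
have least s : ~ A s -> exists2 n, small s n & forall n', small s n' -> (n <= n')%N.
  move=> nAs; have exn : exists n, `[< small s n >].
    by have [n ?] := smallP s nAs; exists n; apply/asboolP.
  case: (ex_minnP exn) => n /asboolP sn nmin; exists n => // n' sn'.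
  by apply: nmin; apply/asboolP.
have [n sn nmin] := least t nAt; have [l sl lmin] := least _ nAt'.
have [ln|/ltnW nl] := leqP l n.
  have [n' n'n /nmin] := step t n l t0 ln sn sl; by rewrite leqNgt n'n.
have [||n' n'l /lmin] := step t^-1 l n _ nl sl; rewrite ?invr_eq0 ?invrK //.
by rewrite leqNgt n'l.
Qed.

End Approximation.

(** * The powers of (f, g) *)

(** Hilbert's basis theorem: each [q n] has least degree among the elements of [J] outside the span
    of the previous ones, and a relation among the leading coefficients yields one of smaller
    degree. *)
Lemma noeth_seq_poly (R : comNzRingType) :
  noeth_seq [set: R] -> noeth_seq [set: {poly R}].
Proof.
move=> Rnoeth u _; apply: contrapT => bad.
pose span (l : seq {poly R}) : set {poly R} :=
  [set p | exists a : nat -> {poly R}, p = \sum_(i < size l) a i * l`_i].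
have genE p l : ideal_gen [set: {poly R}] [set` l] p -> span l p by move/ideal_genP.
have gen_mod l : submodule [set: {poly R}] (span l).
  have -> : span l = ideal_gen [set: {poly R}] [set` l] by apply/seteqP; split=> p /ideal_genP.
  by have /is_idealP[] := @ideal_gen_is_ideal _ _ (setT_subring {poly R}) [set` l] (fun _ _ => I).
have span_mem l p : p \in l -> span l p.
  by move=> lp; apply/genE; apply: sub_gen_smallest.
have span_sub l l' : [set` l] `<=` span l' -> span l `<=` span l'.
  move=> ll' p [a ->]; apply: (submod_sum (gen_mod l')) => i _.
  by apply: (submodM (gen_mod l')) => //; apply: ll'; exact: mem_nth.
pose J := \bigcup_n span (mkseq u n).
have Jmono n k : (n <= k)%N -> span (mkseq u n) `<=` span (mkseq u k).
  move=> nk; apply: span_sub => p /mapP[i]; rewrite mem_iota add0n => /andP[_ ik] ->.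
  by apply: span_mem; apply: map_f; rewrite mem_iota add0n (leq_trans ik).
have Jmod : submodule [set: {poly R}] J.
  split=> [|a b [n _ Ja] [k _ Jb]|a b _ [n _ Jb]].
  - by exists 0%N => //; exact: submod0 (gen_mod _).
  - exists (maxn n k) => //; apply: (submodD (gen_mod _)).
      exact: (Jmono n _ (leq_maxl _ _)).
    exact: (Jmono k _ (leq_maxr _ _)).
  - by exists n => //; exact: (submodM (gen_mod _)).
have Jfg l : [set` l] `<=` J -> exists2 p, J p & ~ span l p.
  move=> lJ; have [n ln] : exists n, [set` l] `<=` span (mkseq u n).
    elim: l lJ => [|v l IHl] lJ; first by exists 0%N.
    have [|n ln] := IHl; first by move=> w lw; apply: lJ; rewrite /= inE lw orbT.
    have [k _ Jv] : J v by apply: lJ; rewrite /= inE eqxx.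
    exists (maxn n k) => w; rewrite /= inE => /orP[/eqP->|lw].
      exact: (Jmono k _ (leq_maxr _ _)).
    by apply: (Jmono n _ (leq_maxl _ _)); exact: ln.
  exists (u n).
    exists n.+1 => //; apply: span_mem; apply: map_f; by rewrite mem_iota add0n leqnn.
  move=> /(span_sub _ _ ln)[a un]; apply: bad; exists n, a; split=> //.
  rewrite un size_mkseq; apply: eq_bigr => i _; by rewrite nth_mkseq.
have /choice[nxt nxtP] : forall l, exists p, [set` l] `<=` J ->
    [/\ J p, ~ span l p & forall q, J q -> ~ span l q -> (size p <= size q)%N].
  move=> l; have [lJ|nlJ] := pselect ([set` l] `<=` J); last by exists 0.
  have [p Jp lp] := Jfg l lJ.
  pose ok n := `[< exists q, [/\ J q, ~ span l q & size q = n] >].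
  have exok : exists n, ok n by exists (size p); apply/asboolP; exists p.
  case: (ex_minnP exok) => n /asboolP[q [Jq lq <-]] qmin.
  exists q => _; split=> // r Jr lr; apply: qmin; apply/asboolP; by exists r.
pose L := fix L n := if n is n'.+1 then rcons (L n') (nxt (L n')) else [::].
pose q n := nxt (L n).
have LE n : L n = mkseq q n by elim: n => // n IHn; rewrite mkseqS -IHn.
have LJ n : [set` L n] `<=` J.
  elim: n => [//|n IHn] p; rewrite /= mem_rcons inE => /orP[/eqP->|]; last exact: IHn.
  by case: (nxtP _ IHn).
have qP n := nxtP _ (LJ n).
have Lmono n k : (n <= k)%N -> span (L n) `<=` span (L k).
  rewrite !LE => nk; apply: span_sub => p /mapP[i]; rewrite mem_iota add0n => /andP[_ ik] ->.
  by apply: span_mem; apply: map_f; rewrite mem_iota add0n (leq_trans ik).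
have qsize i n : (i <= n)%N -> (size (q i) <= size (q n))%N.
  move=> i_n; have [_ _ +] := qP i; apply; first by case: (qP n).
  by move=> /(Lmono _ _ i_n); case: (qP n).
have [n [a [_ lcn]]] := Rnoeth (fun i => lead_coef (q i)) (fun _ => I).
pose s := \sum_(i < n) (a i)%:P * 'X^(size (q n) - size (q i)) * q i.
have Ls : span (L n) s.
  apply: (submod_sum (gen_mod _)) => i _; apply: (submodM (gen_mod _)) => //.
  by apply: span_mem; rewrite LE; apply: map_f; rewrite mem_iota add0n ltn_ord.
have [Jq nLq qmin] := qP n.
have : (size (q n) <= size (q n - s)%R)%N.
  apply: qmin.
    apply: (submodB (setT_subring _) Jmod) => //.
    by apply: (submod_sum Jmod) => i _; apply: (submodM Jmod) => //; case: (qP i).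
  by move=> Ld; apply: nLq; rewrite -[nxt _](subrK s); apply: (submodD (gen_mod _)).
have q0 : q n != 0 by apply/eqP => q0; apply: nLq; rewrite -/(q n) q0; exact: submod0 (gen_mod _).
have sq : (0 < size (q n))%N by rewrite size_poly_gt0.
have sle : (size s <= size (q n))%N.
  apply: leq_trans (size_sum _ _ _) _; apply/bigmax_leqP => i _.
  rewrite -mulrA mul_polyC; apply: leq_trans (size_scale_leq _ _) _.
  apply: leq_trans (size_polyMleq _ _) _; rewrite size_polyXn addSn /=.
  by rewrite subnK // qsize // ltnW.
have cs : s`_(size (q n)).-1 = lead_coef (q n).
  rewrite lcn coef_sum; apply: eq_bigr => i _.
  have qi0 : q i != 0.
    by apply/eqP => qi0; case: (qP i) => _ + _; rewrite -/(q i) qi0; apply; exact: submod0 (gen_mod _).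
  have si : (0 < size (q i))%N by rewrite size_poly_gt0.
  have sin : (size (q i) <= size (q n))%N by rewrite qsize // ltnW.
  rewrite -mulrA coefCM coefXnM ifF; last first.
    by apply/negbTE; rewrite -leqNgt -ltnS prednK // ltn_subrL si sq.
  rewrite lead_coefE; congr (_ * _`_ _).
  by rewrite -subn1 -subnDA addnC subnDA subn1 subKn.
rewrite leqNgt => /negP; apply; rewrite -[X in (_ < X)%N](prednK sq) ltnS.
apply/leq_sizeP => j; rewrite leq_eqVlt => /orP[/eqP <-|jq].
  by rewrite coefB cs lead_coefE subrr.
rewrite prednK // in jq.
by rewrite coefB !nth_default ?subrr // (leq_trans sle).
Qed.

Lemma fraction_repr (R : idomainType) (u : {fraction R}) :
  exists a b : R, b != 0 /\ u = a%:F / b%:F.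
Proof.
suff [a [b [b0 ub]]] : exists a b : R, b != 0 /\ u * b%:F = a%:F.
  by exists a, b; split=> //; rewrite -ub mulfK // tofrac_eq0.
elim/quotW: u => r; exists r.1, r.2; split; first exact: denom_ratioP.
apply/eqP; rewrite !piE /= /FracField.equivf /= !numden_Ratio ?oner_neq0 ?mulf_neq0 ?denom_ratioP ?oner_neq0 //.
by rewrite !mulr1 mulrC.
Qed.

Section MinimalIndex.
Variables (R : comUnitRingType) (m : set R).
Hypothesis munit : forall u, ~ m u -> u \is a GRing.unit.

(** Gauss's argument: take the least [i0] with [s]_i0[a unit and the least]j0[with]p[_j0] outside
    [J], and compare coefficients at [i0 + j0]. It is applied with [J] equal to the maximal ideal
    and to (f, g). *)
Lemma unit_coef_cancel (J : set R) (s p : {poly R}) : submodule [set: R] J ->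
  (exists i, ~ m s`_i) -> (forall a j, m a -> J (a * p`_j)) ->
  (forall k, J (s * p)`_k) -> forall j, J p`_j.
Proof.
move=> Jmod [i si] mp sp j; apply: contrapT => pj.
have exi : exists i, `[< ~ m s`_i >] by exists i; apply/asboolP.
have exj : exists j, `[< ~ J p`_j >] by exists j; apply/asboolP.
case: (ex_minnP exi) => i0 /asboolP si0 imin.
case: (ex_minnP exj) => j0 /asboolP pj0 jmin.
apply: pj0; rewrite -[p`_j0](mulKr (munit si0)).
apply: (submodM Jmod) => //; move: (sp (i0 + j0)%N); rewrite coefM.
have ilt : (i0 < (i0 + j0).+1)%N by rewrite ltnS leq_addr.
rewrite (bigD1 (Ordinal ilt)) //= addKn => Jsum.
rewrite -[_ * _](addrK (\sum_(i' < (i0 + j0).+1 | i' != Ordinal ilt) s`_i' * p`_(i0 + j0 - i'))).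
apply: (submodB (setT_subring R) Jmod) => //; apply: (submod_sum Jmod) => l /eqP li0.
have [lti|gti|eqi] := ltngtP (l : nat) i0.
- apply: mp; apply: contrapT => sl.
  by have := imin l; rewrite leqNgt lti => /(_ (asboolT sl)).
- apply: (submodM Jmod) => //; apply: contrapT => pl.
  have := jmin (i0 + j0 - l)%N (asboolT pl).
  have lle : (l <= i0 + j0)%N by rewrite -ltnS.
  by rewrite leq_subRL // leq_add2r leqNgt gti.
- by case: li0; apply/val_inj.
Qed.

End MinimalIndex.

Section Blowup.
Variables (R : idomainType) (m : set R) (x y : R) (P : params m x y) (f g : R).
Let K := {fraction R}.
Implicit Types (p q s : {poly R}).

Definition evz p : K := (map_poly (@FracField.tofrac R) p).[f%:F / g%:F].

Lemma evzD p q : evz (p + q) = evz p + evz q.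
Proof. by rewrite /evz rmorphD hornerD. Qed.
Lemma evzB p q : evz (p - q) = evz p - evz q.
Proof. by rewrite /evz rmorphB hornerD hornerN. Qed.
Lemma evzM p q : evz (p * q) = evz p * evz q.
Proof. by rewrite /evz rmorphM hornerM. Qed.
Lemma evzC a : evz a%:P = a%:F.
Proof. by rewrite /evz map_polyC hornerC. Qed.
Lemma evz1 : evz 1 = 1.
Proof. by rewrite -polyC1 evzC tofrac1. Qed.
Lemma evzX : evz 'X = f%:F / g%:F.
Proof. by rewrite /evz map_polyX hornerX. Qed.
Lemma evz_sum n (F : 'I_n -> {poly R}) : evz (\sum_(i < n) F i) = \sum_(i < n) evz (F i).
Proof. by apply: (big_morph evz evzD); rewrite evzC tofrac0. Qed.

(* The form of degree [l] with the coefficients of [p], at [(f, g)]. *)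
Definition homog (p : {poly R}) l := \sum_(i < l.+1) p`_i * f ^+ i * g ^+ (l - i).

Hypothesis (g0 : g != 0).

Lemma gF0 : g%:F != 0 :> K. Proof. by rewrite tofrac_eq0. Qed.

Lemma homogE p l : (size p <= l.+1)%N -> (homog p l)%:F = evz p * g%:F ^+ l.
Proof.
move=> pl; rewrite /evz (horner_coef_wide _ (n := l.+1)); last first.
  by apply: leq_trans pl; exact: size_poly.
rewrite mulr_suml rmorph_sum; apply: eq_bigr => i _.
rewrite coef_map /= !tofracM !tofracXn expr_div_n -!mulrA; congr (_ * (_ * _)).
have il : (i <= l)%N by rewrite -ltnS.
have -> : g%:F ^+ l = g%:F ^+ (l - i) * g%:F ^+ i :> K by rewrite -exprD subnK.
by rewrite mulrCA mulVf ?mulr1 // expf_neq0 // gF0.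
Qed.

(* The ideal [(f, g) ^ l]: forms of degree [l] in [f, g] are written as
   [p(f / g) g ^ l]. *)
Definition genpow l : set R :=
  [set u | exists2 p : {poly R}, (size p <= l.+1)%N & u%:F = evz p * g%:F ^+ l].

Lemma genpow_homog l u : genpow l u <-> exists p : {poly R}, u = homog p l.
Proof.
split=> [[p pl up]|[p ->]].
  by exists p; apply/eqP; rewrite -tofrac_eq homogE // up.
exists (\poly_(i < l.+1) p`_i); first exact: size_poly.
rewrite -homogE ?size_poly //; congr (_%:F); apply: eq_bigr => i _.
by rewrite coef_poly ltn_ord.
Qed.

Lemma genpow_mod l : submodule [set: R] (genpow l).
Proof.
split=> [|a b [p pl ap] [q ql bq]|a b _ [p pl bp]].
- by exists 0; rewrite ?size_poly0 // (_ : 0 = 0%:P) // evzC tofrac0 mul0r.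
- exists (p + q); first by rewrite (leq_trans (size_polyD _ _)) // geq_max pl.
  by rewrite tofracD ap bq evzD mulrDl.
- exists (a%:P * p); first by rewrite mul_polyC (leq_trans (size_scale_leq _ _)).
  by rewrite tofracM bp evzM evzC mulrA.
Qed.

Lemma genpowM k l a b : genpow k a -> genpow l b -> genpow (k + l) (a * b).
Proof.
move=> [p pk ap] [q ql bq]; exists (p * q); last first.
  by rewrite tofracM ap bq evzM exprD mulrACA.
apply: leq_trans (size_polyMleq _ _) _.
rewrite -subn1 leq_subLR add1n -addnS -addSn; exact: leq_add.
Qed.

Lemma genpow_monom l i : (i <= l)%N -> genpow l (f ^+ i * g ^+ (l - i)).
Proof.
move=> il; exists 'X^i; first by rewrite size_polyXn.
have -> : g%:F ^+ l = g%:F ^+ (l - i) * g%:F ^+ i :> K by rewrite -exprD subnK.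
rewrite tofracM !tofracXn /evz map_polyXn hornerXn expr_div_n.
by rewrite [_ * g%:F ^+ i]mulrC mulrA divfK // expf_neq0 // gF0.
Qed.

Lemma genpow0 : genpow 0 = [set: R].
Proof.
apply/seteqP; split=> // u _; exists u%:P; first exact: size_polyC_leq1.
by rewrite evzC mulr1.
Qed.

Lemma ideal_exp_genpow n k : ideal_exp [set: R] (genpow n) k = genpow (n * k).
Proof.
elim: k => [|k IHk]; first by rewrite muln0 genpow0.
rewrite /= IHk /ideal_mul; apply/seteqP; split.
  apply: smallest_sub; first by apply/is_idealP; split=> //; exact: genpow_mod.
  by move=> _ [a an [b bnk <-]]; rewrite mulnS; exact: genpowM.
move=> u /genpow_homog[p ->].
set X := [set _ | _ in _ & _ in _].
have /is_idealP[Xmod _] := @ideal_gen_is_ideal R setT (setT_subring R) X (fun _ _ => I).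
apply: (submod_sum Xmod) => -[i /=]; rewrite ltnS => ile _.
rewrite -mulrA; apply: (submodM Xmod) => //; apply: sub_gen_smallest.
have [i_n|n_i] := leqP i n.
  exists (f ^+ i * g ^+ (n - i)); first exact: genpow_monom.
  exists (f ^+ 0 * g ^+ (n * k - 0)); first exact: genpow_monom.
  by rewrite expr0 mul1r subn0 -mulrA -exprD addnBAC // mulnS.
exists (f ^+ n * g ^+ (n - n)); first exact: genpow_monom.
have ile' : (i - n <= n * k)%N by rewrite leq_subLR -mulnS.
exists (f ^+ (i - n) * g ^+ (n * k - (i - n))); first exact: genpow_monom.
rewrite subnn expr0 mulr1 mulrA -exprD subnKC ?(ltnW n_i) //.
by rewrite subnBA ?(ltnW n_i) // mulnS [(n * k + n)%N]addnC.
Qed.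

Lemma ideal_gen_genpow : ideal_gen [set: R] [set f; g] = genpow 1.
Proof.
apply/seteqP; split.
  apply: smallest_sub; first by apply/is_idealP; split=> //; exact: genpow_mod.
  move=> u [->|->]; first by have := @genpow_monom 1 1 isT; rewrite mulr1.
  by have := @genpow_monom 1 0 isT; rewrite mul1r.
have /is_idealP[Xmod _] :=
  @ideal_gen_is_ideal R setT (setT_subring R) [set f; g] (fun _ _ => I).
move=> u /genpow_homog[p ->]; rewrite /homog !big_ord_recl big_ord0 addr0 /= expr0 mulr1 subnn.
rewrite !expr1 expr0 !mulr1; apply: (submodD Xmod); apply: (submodM Xmod) => //.
  by apply: sub_gen_smallest; right.
by apply: sub_gen_smallest; left.
Qed.

Lemma genpow1P u : genpow 1 u <-> exists a b, u = a * f + b * g.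
Proof.
split=> [/genpow_homog[p ->]|[a [b ->]]].
  exists p`_1, p`_0; rewrite /homog !big_ord_recl big_ord0 addr0 /= expr0 mulr1 subnn.
  by rewrite !expr1 expr0 !mulr1 addrC.
apply: (submodD (genpow_mod 1)); apply: (submodM (genpow_mod 1)) => //.
  by have := @genpow_monom 1 1 isT; rewrite mulr1.
by have := @genpow_monom 1 0 isT; rewrite mul1r.
Qed.

(* The Rees algebra [R[f T, g T]], a quotient of [R[X, Y]], is noetherian;
   applied to the sequence [c w ^ i T ^ (n i)] this gives an integral equation. *)
Lemma almost_integral n c w : c != 0 ->
  (forall i, genpow (n * i) (c * w ^+ i)) -> integral_closure (genpow n) w.
Proof.
move=> c0 cw.
pose F : {poly R} := f *: 'X; pose G : {poly R} := g *: 'X.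
(* The map from R[X, Y] to R[T] sending the inner variable to [f T] and the outer one to [g T]; [A]
   describes the Rees algebra by its coefficients. *)
pose Phi (p : {poly {poly R}}) := (map_poly (comp_poly F) p).[G].
pose A := [set r : {poly R} | forall l, genpow l r`_l].
have Aring : subring_set A.
  split=> [l|a b Aa Ab l|a b Aa Ab l].
  - rewrite coef1; case: l => [|l]; first by rewrite genpow0.
    exact: submod0 (genpow_mod _).
  - by rewrite coefB; exact: (submodB (setT_subring R) (genpow_mod l)).
  - rewrite coefM; apply: (submod_sum (genpow_mod l)) => i _.
    have il : (i <= l)%N by rewrite -ltnS.
    by rewrite -[l in genpow l](subnKC il); exact: genpowM.
have AX h : genpow 1 h -> A (h *: 'X).
  move=> h1 l; rewrite coefZ coefX; case: eqP => [->|_]; rewrite ?mulr1 //.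
  by rewrite mulr0; exact: submod0 (genpow_mod _).
have AF : A F by apply: AX; apply/genpow1P; exists 1, 0; ring.
have AG : A G by apply: AX; apply/genpow1P; exists 0, 1; ring.
have AC a : A a%:P.
  move=> l; rewrite coefC; case: eqP => [->|_]; first by rewrite genpow0.
  exact: submod0 (genpow_mod _).
have APhi (p : {poly {poly R}}) : A (Phi p).
  rewrite /Phi horner_coef; apply: (subring_sum Aring) => j _.
  apply: (subringM Aring); last exact: (subringX Aring).
  rewrite coef_map /= comp_polyE; apply: (subring_sum Aring) => i _.
  by rewrite -mul_polyC; apply: (subringM Aring) => //; exact: (subringX Aring).
have Phi_lift l u : genpow l u -> exists p : {poly {poly R}}, Phi p = u *: 'X^l.
  move=> /genpow_homog[q ->]; exists (\sum_(i < l.+1) (q`_i *: 'X^i)%:P * 'X^(l - i)).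
  rewrite /Phi rmorph_sum horner_sum scaler_suml; apply: eq_bigr => i _.
  rewrite rmorphM /= map_polyC map_polyXn hornerM hornerC hornerXn.
  have il : (i <= l)%N by rewrite -ltnS.
  have -> : 'X^l = 'X^i * 'X^(l - i) :> {poly R} by rewrite -exprD subnKC.
  rewrite /= comp_polyZ comp_Xn_poly !exprZn -!mul_polyC !polyCM; ring.
have [p pE] := choice (fun i => Phi_lift _ _ (cw i)).
have polynoeth := noeth_seq_poly (noeth_seq_poly (par_noeth P)).
have [N [a [_ pN]]] := polynoeth p (fun _ => I).
(* Only this homogeneous component of [Phi (a j)] contributes to the coefficient of T^(nN) in the
   relation; cancelling [c] then gives the equation for [w]. *)
pose b j := (Phi (a j))`_(n * (N - j)).
have bform j : genpow (n * (N - j)) (b j) by exact: APhi.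
have wN : w ^+ N = \sum_(j < N) b j * w ^+ j.
  apply: (mulfI c0); have := congr1 (fun q => q`_(n * N)) (pE N).
  rewrite /= coefZ coefXn eqxx mulr1 => <-.
  rewrite pN /Phi rmorph_sum horner_sum coef_sum mulr_sumr; apply: eq_bigr => j _.
  rewrite rmorphM hornerM -!/(Phi _) pE -scalerAr coefZ coefMXn.
  have jN : (n * j <= n * N)%N by rewrite leq_mul2l (ltnW (ltn_ord j)) orbT.
  by rewrite ltnNge jN /= -mulnBr /b; ring.
pose q : {poly R} := \poly_(j < N) b j.
have qN : (size q < (size ('X^N : {poly R})))%N by rewrite size_polyXn ltnS size_poly.
have szq : size ('X^N - q) = N.+1 by rewrite size_polyDl ?size_polyN // size_polyXn.
exists ('X^N - q); split.
- by rewrite monicE lead_coefDl ?size_polyN // lead_coefXn.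
- rewrite /root hornerD hornerN hornerXn wN /q horner_poly subrr //.
- rewrite szq /= => i iN; rewrite ideal_exp_genpow coefB coefXn ltn_eqF // sub0r coef_poly iN.
  by apply: (submodN (setT_subring R) (genpow_mod _)).
Qed.

End Blowup.

(** * Dicritical divisors *)

Section DicriticalRing.
Variables (R : idomainType) (m : set R) (x y : R) (P : params m x y) (f g : R).
Let K := {fraction R}.
Local Notation ev := (evz f g).
Local Notation FG := (genpow f g 1).
Implicit Types (p q s : {poly R}).

Hypotheses (g0 : g != 0) (mf : m f) (mg : m g).
Hypothesis reg : forall a b, f * a = g * b -> exists c, a = g * c.
Variables (k : nat).
Hypotheses (xk : FG (x ^+ k)) (yk : FG (y ^+ k)).

Let gF0 : g%:F != 0 :> K. Proof. by rewrite tofrac_eq0. Qed.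

Let Imod : submodule [set: R] FG. Proof. exact: genpow_mod. Qed.

Let zg : f%:F / g%:F * g%:F = f%:F :> K. Proof. by rewrite mulfVK. Qed.

Lemma regX n a b : f ^+ n * a = g * b -> exists c, a = g * c.
Proof.
elim: n a b => [|n IHn] a b; first by rewrite mul1r => ->; exists b.
by rewrite exprS -mulrA => /reg[c /IHn].
Qed.

(** For a regular sequence the kernel of evaluation at f/g is generated by [g X - f]: regularity
    makes [g] divide the top coefficient of [p], and subtracting a multiple of this linear
    polynomial lowers the degree. *)
Lemma evz_ker p i : ev p = 0 -> FG p`_i.
Proof.
have : (size p <= (size p).+1)%N by [].
move: {2}(size p) => n; elim: n p i => [|n IHn] p i pn evp.
  have hom0 : homog f g p 0 = 0.
    by apply/eqP; rewrite -tofrac_eq0 (homogE f g0 pn) evp mul0r.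
  case: i => [|i]; last first.
    by rewrite nth_default ?(leq_trans pn) //; exact: submod0 Imod.
  move: hom0; rewrite /homog big_ord_recl big_ord0 addr0 !mulr1 => ->.
  exact: submod0 Imod.
have hom0 : homog f g p n.+1 = 0.
  by apply/eqP; rewrite -tofrac_eq0 (homogE f g0 pn) evp mul0r.
have [c pc] : exists c, p`_n.+1 = g * c.
  apply: (@regX n.+1 _ (- \sum_(j < n.+1) p`_j * f ^+ j * g ^+ (n - j))).
  move: hom0; rewrite /homog big_ord_recr /= subnn mulr1 => /eqP.
  rewrite addrC addr_eq0 => /eqP; rewrite mulrC => ->; rewrite mulrN mulr_sumr.
  congr (- _); apply: eq_bigr => j _.
  have jn : (j <= n)%N by rewrite -ltnS.
  by rewrite subSn // exprS; ring.
pose q : {poly R} := g *: 'X - f%:P.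
have Iq j : FG (c * q`_j).
  apply: (submodM Imod) => //; rewrite /q coefB coefZ coefX coefC; apply/genpow1P => //.
  by exists (- (j == 0)%:R), (j == 1)%:R; case: j => [|[|j]] /=; ring.
have evq : ev q = 0.
  by rewrite /q evzB -mul_polyC evzM !evzC evzX mulrC zg subrr.
have -> : p`_i = (p - c *: (q * 'X^n))`_i + (c *: (q * 'X^n))`_i by rewrite coefB subrK.
apply: (submodD Imod); last first.
  rewrite coefZ coefMXn; case: ifP => _; last exact: Iq.
  by rewrite mulr0; exact: submod0 Imod.
apply: IHn; last by rewrite evzB -mul_polyC evzM evzM evq mul0r mulr0 evp subrr.
apply/leq_sizeP => j; rewrite leq_eqVlt => /orP[/eqP<-|nj].
  rewrite coefB coefZ coefMXn ltnNge leqnSn /= subSn // subnn.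
  by rewrite /q coefB coefZ coefX coefC pc /=; ring.
rewrite coefB coefZ coefMXn ltnNge (leq_trans (leqnSn n) (ltnW nj)) /=.
rewrite nth_default ?(leq_trans pn) // /q coefB coefZ coefX coefC.
rewrite -(subnSK (ltnW nj)) -(subnSK nj) /=; ring.
Qed.

(** The complement of [m R[X]]. The polynomials in [residue_algebraic] satisfy the same condition,
    so that transcendence of f/g makes every such [ev s] a unit of the valuation ring. *)
Definition primitive s := exists i, ~ m s`_i.

Let Im u : FG u -> m u.
Proof.
move=> /(genpow1P f g0)[a [b ->]].
by apply: (submodD (par_mod P)); apply: (submodM (par_mod P)).
Qed.

Lemma primitive_ev s : primitive s -> ev s != 0.
Proof. by move=> [i si]; apply/eqP => /evz_ker => /(_ i)/Im. Qed.

Lemma primitiveM s p : primitive s -> primitive p -> primitive (s * p).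
Proof.
move=> Ps [j pj]; apply: contrapT => nsp; apply: pj.
apply: (unit_coef_cancel (par_unit P) (par_mod P) Ps) => [a i ma|i].
  by rewrite mulrC; exact: (submodM (par_mod P)).
by apply: contrapT => spi; apply: nsp; exists i.
Qed.

Lemma primitive1 : primitive 1.
Proof. by exists 0%N; rewrite coef1; exact: par_m1 P. Qed.

Lemma primitiveBg s p a : m a -> primitive s -> primitive (s - a *: p).
Proof.
move=> ma [i si]; exists i; rewrite coefB coefZ => msi; apply: si.
rewrite -[s`_i](subrK (a * p`_i)); apply: (submodD (par_mod P)) => //.
by rewrite mulrC; exact: (submodM (par_mod P)).
Qed.

(* [(x ^+ k, y ^+ k)] annihilates [p] modulo [(f, g)], and an element [t] such
   that [x t] and [y t] do so does it as well. *)
Lemma primitive_cancel s p : primitive s -> (forall i, FG (s * p)`_i) -> forall i, FG p`_i.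
Proof.
move=> Ps sp.
pose E t := forall i, FG (t * p`_i).
have EM a t : E t -> E (a * t).
  by move=> Et i; rewrite -mulrA; exact: (submodM Imod).
have Estep t : E (x * t) -> E (y * t) -> E t.
  move=> Ext Eyt i; rewrite -coefZ.
  apply: (unit_coef_cancel (par_unit P) Imod Ps) => [a j /(par_mE P)[b [c ->]]|j].
    rewrite coefZ mulrDl -!mulrA !(mulrA _ t); apply: (submodD Imod).
      by apply: (submodM Imod).
    by apply: (submodM Imod).
  by rewrite -scalerAr coefZ; exact: (submodM Imod).
have Ey j : forall t, E (x * t) -> E (y ^+ j * t) -> E t.
  elim: j => [|j IHj] t Ext; first by rewrite mul1r.
  move=> Eyt; apply: Estep => //; apply: IHj; first by rewrite mulrCA; exact: EM.
  by rewrite mulrA -exprSr.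
have Ex i : forall t, E (x ^+ i * t) -> E (y ^+ k * t) -> E t.
  elim: i => [|i IHi] t; first by rewrite mul1r.
  move=> Ext Eyt; apply: (Ey k) => //; apply: IHi; first by rewrite mulrA -exprSr.
  by rewrite mulrCA; exact: EM.
have EI t : FG t -> E (t * 1).
  by move=> It i; rewrite mulr1 mulrC; exact: (submodM Imod).
move=> i; rewrite -[p`_i]mul1r; apply: (Ex k 1); exact: EI.
Qed.

(* The localization of [R[f / g]] at [m R[f / g]]. *)
Definition dring : set K :=
  [set u | exists p s, primitive s /\ u = ev p / ev s].

Lemma dring_ring : subring_set dring.
Proof.
split.
- exists 1, 1; split; first exact: primitive1.
  by rewrite evz1 divr1.
- move=> _ _ [p [s [Ps ->]]] [q [t [Pt ->]]].
  exists (p * t - q * s), (s * t); split; first exact: primitiveM.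
  by rewrite evzB !evzM -mulNr addf_div ?primitive_ev // mulNr.
- move=> _ _ [p [s [Ps ->]]] [q [t [Pt ->]]].
  exists (p * q), (s * t); split; first exact: primitiveM.
  by rewrite !evzM mulf_div.
Qed.

Lemma dring_ev p : dring (ev p).
Proof.
exists p, 1; split; first exact: primitive1.
by rewrite evz1 divr1.
Qed.

Lemma dring_base a : dring a%:F.
Proof. by rewrite -(evzC f g); exact: dring_ev. Qed.

Lemma dring_z : dring (f%:F / g%:F).
Proof. by rewrite -evzX; exact: dring_ev. Qed.

Lemma dring_inv s : primitive s -> dring (ev s)^-1.
Proof.
move=> Ps; exists 1, s; split=> //.
by rewrite evz1 div1r.
Qed.

Lemma dring_local u : dring u -> (exists2 v, dring v & u * v = 1)
  \/ exists a b, [/\ dring a, dring b & u = a * x%:F + b * y%:F].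
Proof.
move=> [p [s [Ps ->]]]; have [Pp|nPp] := pselect (primitive p).
  left; exists (ev s / ev p); first by exists s, p.
  by rewrite mulrA divfK ?divff ?primitive_ev.
right; have /choice[a] : forall i, exists a, exists b, p`_i = a * x + b * y.
  by move=> i; apply/(par_mE P); apply: contrapT => mpi; apply: nPp; exists i.
move=> /choice[b ab].
pose A := \poly_(i < size p) a i; pose B := \poly_(i < size p) b i.
have pE : p = A * x%:P + B * y%:P.
  apply/polyP => i; rewrite coefD !coefMC !coef_poly; case: ltnP => [_|pi]; first exact: ab.
  by rewrite nth_default // !mul0r addr0.
exists (ev A / ev s), (ev B / ev s); split; [by exists A, s|by exists B, s|].
by rewrite pE evzD !evzM !evzC; ring.
Qed.

Lemma dring_gunit c : dring c -> exists2 d, dring d & (1 - g%:F * c) * d = 1.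
Proof.
move=> [p [s [Ps ->]]]; have Pd := primitiveBg p mg Ps.
exists (ev s / ev (s - g *: p)); first by exists s, (s - g *: p).
have s0 := primitive_ev Ps; have d0 := primitive_ev Pd.
have dE : ev (s - g *: p) = ev s - g%:F * ev p by rewrite evzB -mul_polyC evzM evzC.
have aux (F : fieldType) (a b d : F) : b != 0 -> b - a * d != 0 ->
    (1 - a * (d / b)) * (b / (b - a * d)) = 1.
  by move=> b0 bad0; field; rewrite bad0.
by rewrite dE in d0 *; exact: aux.
Qed.

Lemma dring_noeth : noeth_seq dring.
Proof.
move=> u Nu.
have /choice[p /choice[s ps]] : forall i, exists p, exists s, primitive s /\ u i = ev p / ev s.
  by move=> i; exact: Nu.
have [n [a [_ pn]]] := noeth_seq_poly (par_noeth P) (fun i => I : [set: {poly R}] (p i)).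
exists n, (fun i => ev (a i * s i) / ev (s n)); split=> [i|].
  by exists (a i * s i), (s n); split=> //; case: (ps n).
have [_ ->] := ps n; rewrite pn evz_sum mulr_suml; apply: eq_bigr => i _.
have [Psi ->] := ps i; rewrite !evzM.
have aux (F : fieldType) (a' b c d : F) : c != 0 -> a' * b / d = a' * c / d * (b / c).
  by move=> c0; rewrite -[X in X / d](divfK c0); ring.
by apply: aux; exact: primitive_ev.
Qed.

Let Ig u : FG u -> exists2 c, dring c & u%:F = g%:F * c.
Proof.
move=> /(genpow1P f g0)[a [b ->]]; exists (a%:F * (f%:F / g%:F) + b%:F).
  apply: (subringD dring_ring); last exact: dring_base.
  by apply: (subringM dring_ring); [exact: dring_base|exact: dring_z].
by rewrite mulrDr mulrCA [g%:F * (_ / _)]mulrC zg tofracD !tofracM [g%:F * _]mulrC.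
Qed.

(** In [dring] the extension of (f, g) is generated by [g], so [xk] and [yk] make powers of [x] and
    [y] multiples of [g]. *)
Lemma dring_flen : exists n, flen dring g%:F x%:F y%:F dring n.
Proof.
have [c Nc xc] := Ig xk; have [d Nd yd] := Ig yk; rewrite !tofracXn in xc yd.
apply: (flen_full dring_ring _ _ _ Nc Nd xc yd); exact: dring_base.
Qed.

Lemma dring_height1 b : dring b -> b != 0 ->
  exists l, exists2 c, dring c & g%:F ^+ l = b * c.
Proof.
move=> Nb b0; have [n flenN] := dring_flen.
exact: (principal_ideal_thm dring_ring dring_noeth (dring_base g) dring_local
  dring_gunit flenN Nb b0).
Qed.

Lemma dring_denominator (u : K) : exists c, dring (g%:F ^+ c * u).
Proof.
have [a [b [b0 ->]]] := fraction_repr u.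
have [||l [c Nc gl]] := @dring_height1 b%:F; rewrite ?tofrac_eq0 //.
  exact: dring_base.
exists l; rewrite gl mulrAC [b%:F * _]mulrCA divff ?tofrac_eq0 // mulr1.
by apply: (subringM dring_ring) => //; exact: dring_base.
Qed.

(** This carries the form ring argument. Modulo (f, g), the denominator [s] is cancelled by
    [primitive_cancel], so [p = A * f + B * g] and [ev p] is [g] times the value of [A * 'X + B].
    Each such division by [g] raises the degree bound by one, which for constant [p] is exactly
    membership in (f, g)^l. *)
Lemma dring_divX l e p : (size p <= e.+1)%N -> dring (ev p / g%:F ^+ l) ->
  exists2 q : {poly R}, (size q <= (e + l).+1)%N & ev p = ev q * g%:F ^+ l.
Proof.
elim: l e p => [|l IHl] e p pe; first by exists p; rewrite ?addn0 ?mulr1.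
move=> [r [s [Ps prs]]].
have ker : ev (s * p - (g ^+ l.+1) *: r) = 0.
  rewrite evzB -mul_polyC !evzM evzC tofracXn.
  have -> : ev p = ev r / ev s * g%:F ^+ l.+1 by rewrite -prs divfK ?expf_neq0.
  by rewrite mulrA [ev s * _]mulrC divfK ?primitive_ev // mulrC subrr.
have /choice[a /choice[b ab]] : forall i, exists a b, p`_i = a * f + b * g.
  move=> i; apply/(genpow1P f g0); move: i; apply: (primitive_cancel Ps) => i.
  rewrite -[(s * p)`_i](subrK ((g ^+ l.+1) *: r)`_i) -coefB.
  apply: (submodD Imod); first exact: evz_ker.
  by rewrite coefZ; apply/(genpow1P f g0); exists 0, (g ^+ l * r`_i); rewrite exprS; ring.
pose A := \poly_(i < e.+1) a i; pose B := \poly_(i < e.+1) b i.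
have pE : p = A * f%:P + B * g%:P.
  apply/polyP => i; rewrite coefD !coefMC !coef_poly; case: ltnP => [_|ie]; first exact: ab.
  by rewrite nth_default ?(leq_trans pe) // !mul0r addr0.
have evp : ev p = g%:F * ev (A * 'X + B).
  by rewrite pE !evzD !evzM !evzC evzX -{1}zg; ring.
have [||q qe evq] := IHl e.+1 (A * 'X + B).
- apply: leq_trans (size_polyD _ _) _; rewrite geq_max (leq_trans (size_poly _ _)) //.
  apply/andP; split=> //; apply: leq_trans (size_polyMleq _ _) _.
  by rewrite size_polyX addn2 /= ltnS size_poly.
- exists r, s; split=> //; rewrite -prs evp exprS invfM.
  by rewrite mulrACA divff // mul1r.
exists q; first by rewrite addnS -addSn.
by rewrite evp evq exprS; ring.
Qed.

Lemma dring_genpow l w : dring (w%:F / g%:F ^+ l) -> genpow f g l w.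
Proof.
rewrite -(evzC f g) => /(dring_divX (size_polyC_leq1 w))[q ql wq].
by exists q; rewrite // -wq evzC.
Qed.

Lemma dring_integral n d w (a : nat -> K) : (forall i, dring (a i)) ->
  (w%:F / g%:F ^+ n) ^+ d = \sum_(j < d) a j * (w%:F / g%:F ^+ n) ^+ j ->
  integral_closure (genpow f g n) w.
Proof.
set u := w%:F / g%:F ^+ n => Na ud.
(* The powers below [d] have denominators dividing [g ^+ (n * d)], and the integral equation reduces
   all others to them. *)
have Nu i : dring (g%:F ^+ (n * d) * u ^+ i).
  have [j] := ubnP i; elim: j i => // j IHj i; rewrite ltnS => ij.
  have [id|di] := ltnP i d.
    have id' : (n * i <= n * d)%N by rewrite leq_mul2l (ltnW id) orbT.
    have -> : g%:F ^+ (n * d) * u ^+ i = (g ^+ (n * d - n * i) * w ^+ i)%:F.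
      rewrite tofracM !tofracXn /u expr_div_n -exprM.
      have -> : g%:F ^+ (n * d) = g%:F ^+ (n * d - n * i) * g%:F ^+ (n * i) :> K.
        by rewrite -exprD subnK.
      by rewrite -mulrA [X in _ * X = _]mulrC divfK ?expf_neq0.
    exact: dring_base.
  have -> : u ^+ i = u ^+ (i - d) * u ^+ d by rewrite -exprD subnK.
  rewrite ud mulr_sumr mulr_sumr; apply: (subring_sum dring_ring) => l _.
  have -> : g%:F ^+ (n * d) * (u ^+ (i - d) * (a l * u ^+ l))
      = a l * (g%:F ^+ (n * d) * u ^+ (i - d + l)) by rewrite exprD; ring.
  apply: (subringM dring_ring) => //; apply: IHj; apply: leq_trans ij.
  by rewrite -[ltnRHS](subnK di) ltn_add2l.
apply: (almost_integral P g0 (c := g ^+ (n * d))); first by rewrite expf_neq0.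
move=> i; apply: dring_genpow.
by have := Nu i; rewrite tofracM !tofracXn /u expr_div_n -exprM mulrA.
Qed.

Implicit Types V W : set K.

(** A bad sequence [u] generates a strictly ascending chain of principal ideals of [V]. Read
    backwards from [u r], it is a descending chain ending in [u 0 V], which contains [g ^+ k0 V];
    the length bound [n * k0] then fails for [r := (n * k0).+1]. *)
Lemma over_dring_noeth V : is_valuation_ring V -> dring `<=` V -> noeth_seq V.
Proof.
move=> Vval NV u Vu; have Vring := valring_subring Vval.
apply: contrapT => bad.
have ubad j i : (i < j)%N -> ~ V (u j / u i).
  move=> ij Vij; apply: (bad); exists j, (fun l => if l == i then u j / u i else 0).
  split=> [l|]; first by case: ifP => // _; exact: (subring0 Vring).
  rewrite (bigD1 (Ordinal ij)) //= eqxx big1 ?addr0 => [|l /eqP li].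
    have [ui0|ui0] := eqVneq (u i) 0; last by rewrite divfK.
    case: bad; exists i, (fun=> 0); split=> [_|]; first exact: (subring0 Vring).
    by rewrite ui0 big1 // => l _; rewrite mul0r.
  rewrite ifF ?mul0r //; apply/eqP => lE; apply: li; exact: val_inj.
have u0 j : u j != 0.
  apply/eqP => uj0; apply: bad; exists j, (fun=> 0); split=> [_|]; first exact: (subring0 Vring).
  by rewrite uj0 big1 // => l _; rewrite mul0r.
have uV i j : (i <= j)%N -> V (u i / u j).
  rewrite leq_eqVlt => /orP[/eqP->|/ubad/(valring_total Vval)]; last by rewrite invf_div.
  by rewrite divff //; exact: (subring1 Vring).
have [n flenN] := dring_flen.
have [k0 Nk0] := dring_denominator (u 0%N)^-1.
pose r := (n * k0).+1.
have /choice[cs csP] := fun i => dring_denominator (u (r - i)%N).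
pose c := (\sum_(i < r) cs i)%N.
pose Y i := [set t : K | V (t / u (r - i)%N)].
have Ymod i : submodule dring (Y i).
  split=> [|a b Ya Yb|a b Na Yb].
  - by rewrite /Y /= mul0r; exact: (subring0 Vring).
  - by rewrite /Y /= mulrDl; exact: (subringD Vring).
  - by rewrite /Y /= -mulrA; apply: (subringM Vring) => //; exact: NV.
have Ydec i j : (i <= j)%N -> Y j `<=` Y i.
  move=> ij t Yt; rewrite /Y /=.
  have -> : t / u (r - i)%N = t / u (r - j)%N * (u (r - j)%N / u (r - i)%N).
    by rewrite mulrA divfK.
  by apply: (subringM Vring); [exact: Yt|apply: uV; exact: leq_sub2l].
have Vgk t : V t -> Y r (g%:F ^+ k0 * t).
  move=> Vt; rewrite /Y /= subnn mulrAC.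
  by apply: (subringM Vring) => //; exact: NV.
have : (r <= n * k0)%N.
  apply: (krull_akizuki dring_ring (dring_base g) dring_local (e := fun i => u (r - i)%N)
    (c := c) gF0 flenN Ymod Ydec) => [t Yt|b Nb|i ir].
  - apply: Vgk; rewrite -[t](divfK (u0 (r - 0)%N)).
    exact: (subringM Vring).
  - by apply: Vgk; exact: NV.
  - split; first by rewrite /Y /= divff //; exact: (subring1 Vring).
      by apply: ubad; rewrite ltn_sub2l.
    have ci : (cs i <= c)%N by rewrite /c (bigD1 (Ordinal ir)) //= leq_addr.
    rewrite -(subnK ci) exprD -mulrA; apply: (subringM dring_ring) => //.
    apply: (subringX dring_ring); exact: dring_base.
by rewrite ltnn.
Qed.

(** Domination of [dring] can be tested on [g] alone, since powers of [x] and [y] are multiples of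
    [g] there. *)
Lemma dicriticalP V : dicritical_divisors m (f%:F / g%:F) V <->
  [/\ is_DVR V, dring `<=` V & in_max V g%:F].
Proof.
split.
  move=> [mv [[[v vV] Vloc [Vbase mvm] _] Vz ztr]].
  have Vval := DVR_valring vV; have Vring := valring_subring Vval.
  have mvE : nonunits V = mv by apply: Vloc.2; exact: (nonunits_local Vval).1.
  have Vev p : V (ev p).
    rewrite /evz horner_coef; apply: (subring_sum Vring) => i _; rewrite coef_map.
    by apply: (subringM Vring); [exact: Vbase|exact: (subringX Vring)].
  split; first by exists v.
    move=> _ [p [s [Ps ->]]]; apply: (subringM Vring) => //.
    by apply: contrapT => nVs; apply: ztr; exists s; split=> //;
      rewrite -mvE; split; [exact: Vev|right].
  have : nonunits V g%:F by rewrite mvE; apply/mvm.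
  by case=> Vg [/eqP|//]; rewrite (negbTE gF0).
move=> [Vdvr NV [Vg nVg]]; have [v vV] := Vdvr.
have Vval := DVR_valring vV; have Vring := valring_subring Vval.
have Vbase (a : R) : V a%:F by apply: NV; exact: dring_base.
have numod := nonunits_submodule Vval.
have in_nu t : FG (t ^+ k) -> nonunits V t%:F.
  move=> /(genpow1P f g0)[a [b tk]]; split=> //.
  have [->|t0] := eqVneq (t%:F : K) 0; [by left|right=> Vt; apply: nVg].
  have -> : g%:F^-1 = (a%:F * (f%:F / g%:F) + b%:F) * (t%:F : K)^-1 ^+ k.
    rewrite exprVn -tofracXn tk tofracD !tofracM.
    have tk0 : a%:F * f%:F + b%:F * g%:F != 0 :> K.
      by rewrite -!tofracM -tofracD -tk tofracXn expf_neq0.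
    have aux (F : fieldType) (b' c' f' g' : F) : g' != 0 -> b' * f' + c' * g' != 0 ->
        g'^-1 = (b' * (f' / g') + c') * (b' * f' + c' * g')^-1.
      by move=> g'0 d0; field; rewrite g'0 d0.
    exact: aux.
  apply: (subringM Vring); last exact: (subringX Vring).
  apply: (subringD Vring) => //; apply: (subringM Vring) => //; exact: NV _ dring_z.
have nuP p : (exists i, ~ m p`_i) -> ~ nonunits V (ev p).
  move=> Pp [_ [/eqP|]]; first by rewrite (negbTE (primitive_ev Pp)).
  by apply; apply: NV; exact: dring_inv.
have ztr : residue_transcendental m (nonunits V) (f%:F / g%:F).
  by case=> p [Pp /(nuP _ Pp)].
exists (nonunits V); split=> //; last exact: NV _ dring_z.
split=> //; first exact: nonunits_local.
  split=> // a; split=> [nua|/(par_mE P)[b [c ->]]].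
    apply: contrapT => ma; apply: (nuP a%:P); last by rewrite evzC.
    by exists 0%N; rewrite coefC.
  rewrite tofracD !tofracM; apply: (submodD numod); apply: (submodM numod) => //; exact: in_nu.
by exists (f%:F / g%:F) => //; exact: NV _ dring_z.
Qed.

(** As f/g belongs to [V], the extension of (f, g)^n to [V] is generated by [g ^+ n]. *)
Lemma ideal_ext_genpowP V n u : is_valuation_ring V -> dring `<=` V ->
  ideal_ext V (genpow f g n) u <-> V (u / g%:F ^+ n).
Proof.
move=> Vval NV; have Vring := valring_subring Vval.
have gn0 : g%:F ^+ n != 0 :> K by rewrite expf_neq0.
split=> [|Vu].
  have sub : ideal_ext V (genpow f g n) `<=` [set u | V (u / g%:F ^+ n)].
    apply: smallest_sub; last first.
      by move=> _ [a [p pn ap] <-]; rewrite /= ap mulfK //; apply: NV; exact: dring_ev.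
    split=> [a /= Va||a b Va Vb|a b Va Vb] /=.
    - rewrite -[a](divfK gn0); apply: (subringM Vring) => //; apply: NV.
      by rewrite -tofracXn; exact: dring_base.
    - by rewrite mul0r; exact: (subring0 Vring).
    - by rewrite mulrDl; exact: (subringD Vring).
    - by rewrite -mulrA; exact: (subringM Vring).
  exact: sub.
have XV : [set a%:F | a in genpow f g n] `<=` V.
  by move=> _ [a _ <-]; apply: NV; exact: dring_base.
have /is_idealP[Emod _] := ideal_gen_is_ideal Vring XV.
rewrite -[u](divfK gn0); apply: (submodM Emod) => //.
apply: sub_gen_smallest; exists (g ^+ n); last by rewrite tofracXn.
by have := genpow_monom f g0 (leq0n n); rewrite mul1r subn0.
Qed.

Lemma dicritical_integral_closure n w : integral_closure (genpow f g n) w <->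
  forall V, dicritical_divisors m (f%:F / g%:F) V -> ideal_ext V (genpow f g n) w%:F.
Proof.
have gn0 : g%:F ^+ n != 0 :> K by rewrite expf_neq0.
split=> [[p [pmon /eqP pw pform]] V /dicriticalP[[v vV] NV _]|wV].
  have Vval := DVR_valring vV; have Vring := valring_subring Vval.
  apply/(ideal_ext_genpowP _ _ Vval NV).
  pose d := (size p).-1.
  have szp : size p = d.+1 by rewrite prednK // size_poly_gt0 monic_neq0.
  pose a j : K := if (j < d)%N then - (p`_j)%:F / g%:F ^+ (n * (d - j)) else 0.
  have Va j : V (a j).
    rewrite /a; case: ifP => [jd|_]; last exact: (subring0 Vring).
    have := pform j jd; rewrite ideal_exp_genpow // => -[q qn qE].
    rewrite mulNr; apply: (subringN Vring); rewrite qE mulfK ?expf_neq0 //.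
    by apply: NV; exact: dring_ev.
  apply: (@valring_integral _ _ Vval _ d a Va).
  have pd : p`_d = 1 by move/monicP: pmon; rewrite lead_coefE.
  apply: (mulIf (expf_neq0 d gn0)); rewrite -exprMn divfK // mulr_suml.
  have := congr1 (@FracField.tofrac R) pw; rewrite horner_coef szp big_ord_recr /= pd mul1r.
  rewrite tofracD tofracXn tofrac0 => /eqP; rewrite addrC addr_eq0 => /eqP ->.
  rewrite rmorph_sum -sumrN; apply: eq_bigr => -[j /= jd] _; rewrite /a jd tofracM tofracXn.
  have -> : (g%:F ^+ n) ^+ d = g%:F ^+ (n * (d - j)) * (g%:F ^+ n) ^+ j :> K.
    by rewrite exprM -exprD subnK // ltnW.
  have aux (F : fieldType) (b c e h : F) : e != 0 -> h != 0 ->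
      - (b * c) = - b / e * (c / h) * (e * h) by move=> e0 h0; field; rewrite e0 h0.
  by rewrite expr_div_n; apply: aux; rewrite expf_neq0.
have [[d [a [Na ud]]]|nint] := pselect (exists d (a : nat -> K), (forall i, dring (a i)) /\
    (w%:F / g%:F ^+ n) ^+ d = \sum_(j < d) a j * (w%:F / g%:F ^+ n) ^+ j).
  exact: dring_integral Na ud.
have [V [Vval NV nVu]] := exists_valuation dring_ring nint.
have Vring := valring_subring Vval.
have Vg : V g%:F by apply: NV; exact: dring_base.
(* Inverting [g] in [dring] gives the whole fraction field by [dring_denominator], whereas [V]
   misses w/g^n. *)
have nVg : ~ V g%:F^-1.
  move=> Vg'; apply: nVu; set u := _ / _; have [c Nc] := dring_denominator u.
  rewrite -[u](mulKf (expf_neq0 c gF0)) -exprVn; apply: (subringM Vring); last exact: NV.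
  exact: (subringX Vring).
case: nVu; apply/(ideal_ext_genpowP _ _ Vval NV); apply: wV; apply/dicriticalP; split=> //.
apply: noeth_valring_DVR => //; first exact: over_dring_noeth.
by move=> /(_ _ Vg gF0).
Qed.

(* With [Y i] the elements of [V_0, ..., V_r] that lie in [g V_l] for [l < i],
   the chain [Y] has length at most that of [dring / g dring]. *)
Lemma dicritical_finite : finite_set (dicritical_divisors m (f%:F / g%:F)).
Proof.
apply: contrapT => /infiniteP /pcard_leP[F].
have FD i : dicritical_divisors m (f%:F / g%:F) (F i) by exact: funS.
have Finj i j : F i = F j -> i = j by move=> Fij; apply: (@inj _ _ _ F); rewrite ?inE.
have FP i := (dicriticalP (F i)).1 (FD i).
have [n flenN] := dring_flen.
pose r := n.+1.
have Fring i : subring_set (F i).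
  by have [[v vV] _ _] := FP i; exact: (valring_subring (DVR_valring vV)).
have FN i : dring `<=` F i by case: (FP i).
have Fg i : in_max (F i) g%:F by case: (FP i).
have Fdiv i t : F i (t / g%:F) -> F i t.
  move=> Ft; rewrite -[t](divfK gF0); apply: (subringM (Fring i)) => //.
  by case: (Fg i).
have Fgt i t : F i t -> F i (g%:F * t / g%:F) by rewrite mulrAC divff // mul1r.
pose Y i := [set t | forall l, (l < r)%N -> if (l < i)%N then F l (t / g%:F) else F l t].
have Ymod i : submodule dring (Y i).
  split=> [l lr|a b Ya Yb l lr|a b Na Yb l lr].
  - by rewrite mul0r; case: ifP => _; exact: (subring0 (Fring l)).
  - have := Ya l lr; have := Yb l lr; rewrite mulrDl.
    by case: ifP => _ ? ?; exact: (subringD (Fring l)).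
  - have := Yb l lr; rewrite -mulrA.
    by case: ifP => _ ?; apply: (subringM (Fring l)) => //; exact: FN.
have Ydec i j : (i <= j)%N -> Y j `<=` Y i.
  move=> ij t Yt l lr; have := Yt l lr.
  have [li|il] := ltnP l i; first by rewrite (leq_trans li ij).
  by case: ifP => // _; exact: Fdiv.
have /choice[e eP] : forall i, exists e : K, (i < r)%N ->
    [/\ F i e, ~ F i (e / g%:F) & forall l, (l < r)%N -> l != i -> F l (e / g%:F)].
  move=> i; have [ir|] := ltnP i r; last by exists 0.
  (* [DVR_indicator] wants every listed ring to differ from [F i], so slot [i] is filled with the
     spare ring [F r]. *)
  pose W l := if l == i then F r else F l.
  have WE l : W l = F (if l == i then r else l) by rewrite /W; case: ifP.
  have [Fdvr _ _] := FP i.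
  have [|e [Fe nFe We]] := @DVR_indicator K (F i) W r g%:F Fdvr (Fg i).
    move=> l lr; rewrite WE; have [Wdvr _ Wg] := FP (if l == i then r else l).
    split=> // /Finj; case: eqP => // _ ri.
    by rewrite -ri ltnn in ir.
  exists e => _; split=> // l lr li.
  by have := We l lr; rewrite /W (negbTE li).
have /choice[cs csP] := fun i => dring_denominator (e i).
pose c := (\sum_(i < r) cs i)%N.
have : (r <= n * 1)%N.
  apply: (krull_akizuki dring_ring (dring_base g) dring_local (e := e)
    (c := c) gF0 flenN Ymod Ydec) => [t Yt l lr|b Nb l lr|i ir].
  - by rewrite lr expr1; apply: Fgt; exact: (Yt l lr).
  - by rewrite lr expr1; apply: Fgt; exact: FN.
  - have [Fe nFe Fel] := eP i ir; split.
    + move=> l lr; case: ifP => [li|_]; first by apply: Fel => //; rewrite ltn_eqF.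
      have [->//|li] := eqVneq l i; exact: Fdiv (Fel _ _ li).
    + by move=> /(_ i ir); rewrite ltnSn.
    have ci : (cs i <= c)%N by rewrite /c (bigD1 (Ordinal ir)) //= leq_addr.
    rewrite -(subnK ci) exprD -mulrA; apply: (subringM dring_ring) => //.
    apply: (subringX dring_ring); exact: dring_base.
by rewrite muln1 ltnn.
Qed.

Lemma dicritical_minimal (T : set (set K)) : Rees_conditions FG T ->
  dicritical_divisors m (f%:F / g%:F) `<=` T.
Proof.
move=> [/finite_seqP[s sT] Tval Tbase Tint] V DV; apply: contrapT => nTV.
have [Vdvr NV [Vg nVg]] := (dicriticalP V).1 DV; have [v vV] := Vdvr.
have Vval := DVR_valring vV; have Vring := valring_subring Vval.
have [|eps [nVeps Weps]] := @DVR_approximation K V (nth setT s) (size s) Vdvr.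
  move=> i iss; have TW : T (nth setT s i) by rewrite sT /=; exact: mem_nth.
  split; last by move=> WV; rewrite WV in TW.
  have [Wval Wnoeth Wnf] := Tval _ TW.
  apply: noeth_valring_DVR => //; apply: noetherian_seq => //.
  exact: valring_subring.
have Teps W : T W -> W eps.
  rewrite sT /= => Ws; rewrite -[W](nth_index setT Ws).
  by case: (Weps (index W s)); rewrite // index_mem.
have [a [b [b0 epsE]]] := fraction_repr eps.
have bF0 : b%:F != 0 :> K by rewrite tofrac_eq0.
have [l [_ [p [q [Pq ->]]] gl]] := dring_height1 (dring_base b) bF0.
(* Here [eps = a * ev p / (g ^+ l * ev q)]. Homogenizing [p] and [q] in a common degree [N] turns
   numerator and denominator into elements [w] and [S] of R with [w = eps * S]. As [ev q] is a unit
   of [V], the value of [S] at [V] is exactly that of [g ^+ (l + N)]. *)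
pose N := maxn (size p) (size q).
have pN : (size p <= N.+1)%N by rewrite leqW // leq_maxl.
have qN : (size q <= N.+1)%N by rewrite leqW // leq_maxr.
have q0 := primitive_ev Pq.
pose w := a * homog f g p N; pose S := g ^+ l * homog f g q N.
have SE : S%:F = g%:F ^+ (l + N) * ev q.
  by rewrite /S tofracM tofracXn (homogE f g0 qN) exprD -mulrA [ev q * _]mulrC.
have Sform : genpow f g (l + N) S.
  apply: genpowM => //; last by apply/genpow_homog => //; exists q.
  by have := genpow_monom f g0 (leq0n l); rewrite mul1r subn0.
have wE : w%:F = eps * S%:F.
  rewrite SE /w tofracM (homogE f g0 pN) exprD gl epsE.
  have aux (F : fieldType) (a' b' p' q' h : F) : b' != 0 -> q' != 0 ->
      a' * (p' * h) = a' / b' * (b' * (p' / q') * h * q').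
    by move=> b'0 q'0; field; rewrite b'0 q'0.
  exact: aux.
have : integral_closure (genpow f g (l + N)) w.
  have := Tint (l + N)%N; rewrite ideal_exp_genpow // mul1n => -> /= W TW.
  have [Wval _ _] := Tval W TW; have Wring := valring_subring Wval.
  have XW : [set a%:F | a in genpow f g (l + N)] `<=` W.
    by move=> _ [c _ <-]; exact: Tbase.
  have /is_idealP[Emod _] := ideal_gen_is_ideal Wring XW.
  rewrite wE; apply: (submodM Emod); first exact: Teps.
  by apply: sub_gen_smallest; exists S.
move=> /dicritical_integral_closure /(_ V DV) /(ideal_ext_genpowP _ _ Vval NV).
have gln0 : g%:F ^+ (l + N) != 0 :> K by rewrite expf_neq0.
rewrite wE SE mulrCA mulrAC divff // mul1r => Vepsq; apply: nVeps.
rewrite -[eps](mulfK q0); apply: (subringM Vring) => //.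
by apply: NV; exact: dring_inv.
Qed.

Lemma dicritical_Rees : is_Rees_valuations FG (dicritical_divisors m (f%:F / g%:F)).
Proof.
split; last exact: dicritical_minimal.
split=> [|V /dicriticalP[[v vV] _ _]|V /dicriticalP[_ NV _]|n].
- exact: dicritical_finite.
- by split; [exact: DVR_valring vV|exact: DVR_noetherian vV|exact: DVR_not_field vV].
- by move=> a; apply: NV; exact: dring_base.
- rewrite ideal_exp_genpow // mul1n; apply/seteqP; split=> w.
    by move=> /dicritical_integral_closure.
  by move=> ?; exact/dicritical_integral_closure.
Qed.

End DicriticalRing.

(** * The unit ideal, and the conclusion *)

Section UnitIdeal.
Variables (R : idomainType) (m : set R) (f g : R).

Lemma ideal_exp_setT n : ideal_exp [set: R] [set: R] n = [set: R].
Proof.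
elim: n => // n IHn; apply/seteqP; split=> // u _ /=; rewrite IHn.
by apply: sub_gen_smallest; exists u => //; exists 1; rewrite ?mulr1.
Qed.

Lemma integral_closure_setT : integral_closure [set: R] = [set: R].
Proof.
apply/seteqP; split=> // u _; exists ('X - u%:P); split.
- exact: monicXsubC.
- by rewrite root_XsubC.
- by move=> i _; rewrite ideal_exp_setT.
Qed.

Lemma Rees_valuations_setT : is_Rees_valuations [set: R] set0.
Proof.
split=> [|T _ V []]; split=> // n.
by rewrite ideal_exp_setT integral_closure_setT; apply/seteqP; split=> // u _ V [].
Qed.

(** If [g] is a unit, then f/g lies in R and its residue is a root of a linear polynomial. If [g] is
    in [m], so is [f], because [f] is the product of [g] and an element of [V]. *)
Lemma dicritical_set0 : g != 0 -> (forall u, ~ m u -> u \is a GRing.unit) -> ~ m 1 ->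
  ~ (m f /\ m g) -> dicritical_divisors m (f%:F / g%:F) = set0.
Proof.
move=> g0 munit m1 nfg; rewrite -subset0 => V [mv [[_ [[[_ mv0 _ mvM] _ _] _] [Vbase mvm] _] Vz ztr]].
have gF0 : g%:F != 0 :> {fraction R} by rewrite tofrac_eq0.
have [mg|/munit gu] := pselect (m g).
  apply: nfg; split=> //; apply/mvm.
  by rewrite -[f%:F](divfK gF0); apply: mvM => //; apply/mvm.
apply: ztr; exists ('X - (f / g)%:P); split.
  by exists 1%N; rewrite coefB coefX coefC subr0.
rewrite rmorphB /= map_polyX map_polyC hornerXsubC /=.
rewrite (_ : (f / g)%:F = f%:F / g%:F) ?subrr //.
by apply: (mulIf gF0); rewrite divfK // -tofracM divrK.
Qed.

End UnitIdeal.

Theorem proposition2p2 (R : idomainType) (m : set R)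
    (regR : regular_local_ring m 2)
    (z : {fraction R}) (z_neq0 : z != 0)
    (f g : R) (g_neq0 : g != 0) (zE : z = f%:F / g%:F)
    (cofg : relatively_prime f g) :
  is_Rees_valuations (ideal_gen [set: R] [set f; g]) (dicritical_divisors m z).
Proof.
have f_neq0 : f != 0 by apply: contra_neq z_neq0 => f0; rewrite zE f0 tofrac0 mul0r.
have [x [y [Pxy x0 y0 yNx xNy]]] := regular_params regR.
rewrite zE ideal_gen_genpow //.
have [[mf mg]|nfg] := pselect (m f /\ m g); last first.
  rewrite (dicritical_set0 g_neq0 (par_unit Pxy) (par_m1 Pxy) nfg).
  rewrite (_ : genpow f g 1 = [set: R]); first exact: Rees_valuations_setT.
  apply/seteqP; split=> // u _; apply/genpow1P => //.
  have [mf|/(par_unit Pxy) fu] := pselect (m f).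
    have [mg|/(par_unit Pxy) gu] := pselect (m g); first by case: nfg.
    by exists 0, (u / g); rewrite mul0r add0r divrK.
  by exists (u / f), 0; rewrite mul0r addr0 divrK.
have Pyx := params_sym Pxy.
have [i [a [b xi]]] := par_primary Pxy cofg g_neq0.
have [j [c [d yj]]] := par_primary Pyx cofg g_neq0.
have reg u v : f * u = g * v -> exists w, u = g * w.
  exact: (par_regular Pxy x0 yNx cofg).
(* One exponent must serve both parameters, hence the sum. *)
apply: (dicritical_Rees Pxy g_neq0 mf mg reg (k := (i + j)%N)); apply/genpow1P => //.
  by exists (x ^+ j * a), (x ^+ j * b); rewrite exprD xi; ring.
by exists (y ^+ i * c), (y ^+ i * d); rewrite exprD yj; ring.
Qed.
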